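(* Let $d\geq 2$ and let $p$ be such that $\theta(p)>0$. Let $\alpha$ be a real number such that $$\alpha>\frac{4d^2+5d-5}{2d^2+3d-3}\,(3d-1).$$ Then $$\inf_{n\geq 1}\ \inf\bigl\{P_p\bigl(x\longleftrightarrow y\text{ in }\Lambda(n^\alpha)\bigr): x,y\in\Lambda(n)\bigr\}>0.$$
   Context: Site percolation on $\mathbb{Z}^d$ with parameter $p$: each site is declared open with probability $p$ and closed with probability $1-p$, independently; $P_p$ is the corresponding probability. Two sites $x,y$ are neighbors if $|x-y|=1$ (Euclidean distance). $\theta(p)$ is the $P_p$-probability that the origin belongs to an infinite open cluster (infinite connected component of open sites). For a real $r\geq 0$, $\Lambda(r)=[-r,r]^d\cap\mathbb{Z}^d$. For $x,y$ in a box $\Lambda$, $\{x\longleftrightarrow y\text{ in }\Lambda\}$ is the event that $x$ and $y$ are joined by an open path (nearest-neighbor path of open sites, including its endpoints) inside $\Lambda$. *)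

(* Defs.v *)
From HB Require Import structures.
From mathcomp Require Import all_boot all_order all_algebra.
From mathcomp Require Import all_classical all_reals all_analysis.

Set Implicit Arguments.
Unset Strict Implicit.
Unset Printing Implicit Defensive.

Import Order.TTheory GRing.Theory Num.Theory.
Import numFieldNormedType.Exports.

Local Open Scope classical_set_scope.
Local Open Scope ring_scope.

Notation site d := 'rV[int]_d.

(* [true] means open. *)
Definition config (d : nat) := site d -> bool.

Section Lattice.
Context (R : realType) (d : nat).
Implicit Types (x y : site d) (w : config d) (A : set (site d)).

Definition euclidean_dist x y : R :=
  Num.sqrt (\sum_(i < d) (x ord0 i - y ord0 i)%:~R ^+ 2).

Definition neighbor : rel (site d) := fun x y => euclidean_dist x y == 1.

Definition box (r : R) : set (site d) :=
  [set x | forall i : 'I_d, - r <= (x ord0 i)%:~R <= r].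

(* The vertices of the path are those of [x :: s]; when [x = y] the path may be
   reduced to [x], which must then be open. *)
Definition connected_in w A x y : Prop :=
  exists s : seq (site d),
    [/\ path neighbor x s, last x s = y &
        forall z, z \in x :: s -> w z /\ A z].

(* Empty when [x] is closed. *)
Definition open_cluster w x : set (site d) :=
  [set y | connected_in w setT x y].

End Lattice.

Arguments box {R} d r _.
Arguments neighbor R {d}.
Arguments connected_in R {d}.
Arguments open_cluster R {d}.

Section Percolation.
Context {R : realType} {disp : measure_display} {T : measurableType disp}.
Context (P : probability T R).

Definition mutually_independent (I : choiceType) (X : I -> {RV P >-> bool}) :=
  forall (s : seq I) (B : I -> set bool), uniq s ->
    P (\bigcap_(i in [set` s]) (X i @^-1` B i)) =
    (\prod_(i <- s) P (X i @^-1` B i))%E.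

(* The infinite product measure is not in the library; the law P_p of the
   process is determined by these two conditions.  The first one forces
   [0 <= p <= 1]. *)
Definition site_percolation (d : nat) (p : R)
    (X : site d -> {RV P >-> bool}) : Prop :=
  (forall x, P [set t | X x t = true] = p%:E) /\ mutually_independent X.

Definition random_config (d : nat) (X : site d -> {RV P >-> bool}) (t : T) :
  config d := fun x => X x t.

Definition theta (d : nat) (X : site d -> {RV P >-> bool}) : \bar R :=
  P [set t | infinite_set (open_cluster R (random_config X t) 0)].

Definition connection_event (d : nat) (X : site d -> {RV P >-> bool})
    (A : set (site d)) (x y : site d) : set T :=
  [set t | connected_in R (random_config X t) A x y].

End Percolation.

(* Main.v *)
Require Import Defs.
From HB Require Import structures.
From mathcomp Require Import all_boot all_order all_algebra fingroup perm.
From mathcomp Require Import all_classical all_reals all_analysis.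
From mathcomp Require Import ring lra zify.

Import Order.TTheory GRing.Theory Num.Theory.
Import numFieldNormedType.Exports.

(** Let [N = n ^ alpha], let [x] and [y] be sites of the box of size [n], and write
    [A] for the box of size [N]. By Harris' inequality both sites are joined to the
    boundary of [A] with probability at least [theta ^ 2]; so they are joined to each
    other with probability bounded below as soon as it is unlikely that their two
    arms stay apart in [A]. This is proved for enough displacements [y - x] to join
    any two sites of the small box in a bounded number of hops, and Harris'
    inequality multiplies the probabilities of the hops.

    Joining two arms ([separate_conn_le]). If [Q] is a part of [A], then
    P(arms of x and y stay apart) * P(x and y are joined in Q) is at most the sum over
    [u] in [Q] of the probability that [u] has two arms, that is, [u] is closed and
    adjacent to two distinct clusters of [A] that reach the boundary. Indeed, once the
    cluster of [x] has been explored, the sites away from it and from its closed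
    boundary are still independent. In that region the events that [y] has an arm and
    that [y] is linked in [Q] to the closed boundary are both increasing, hence
    positively correlated, and the closed site where the link ends has two arms.

    Displacements ([exists_reachable], [linked_axis]). For every [r], the arm of the
    origin yields a site at distance exactly [r] that is joined to the origin in the
    box of size [r] with probability at least [theta / (2 r + 2) ^ d]. So are its images
    under permutations and changes of sign of the coordinates. Two such images add up
    to [2 r] times any given unit vector, so two hops and at most one unit step
    realize a move along an axis.

    Two-arm estimate ([two_arms_sum], [prob_two_arms_le]). The argument is that of
    Aizenman, Kesten and Newman. In mean, the number of crossing sites and the number of
    closed sites around them are exactly in proportion [p] to [1 - p]. If the closed
    sites are counted separately around each crossing cluster, the sites with two arms
    are counted at least twice. The surplus is the sum over clusters [K] of
    [p |dK| - (1 - p) |K|], where [dK] is the closed boundary. This is of order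
    [|K| ^ (1/2)] because the weights [q ^ |K| * (1 - q) ^ |dK|] of the possible
    clusters of a given site have sum at most one for every density [q]; comparing a
    density [q] slightly below [p] with [p] gives an exponential moment
    ([mean_tilt], [excess_le_tilt]). After averaging over translations, a site deep
    inside [A] has two arms with probability O(N ^ (-1/2)).

    Altogether the arms stay apart with probability O(n ^ (2 d) * N ^ (-1/2)), which
    tends to zero when [alpha > 4 d], and the assumption on [alpha] implies this bound
    ([threshold_ge], [large_scale]). Unit steps alone handle the finitely many small
    [n].

    The finite part of the proof lives on a discrete torus much larger than [A], where
    all lattice symmetries are bijections and the law of the sites is a finite sum;
    [window_law] and [connection_event_window] transport events to and from the
    lattice. *)

Set Implicit Arguments.
Unset Strict Implicit.
Unset Printing Implicit Defensive.

Local Open Scope ring_scope.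

(** * Independent sites on a finite set *)

Section ProductMeasure.
Context (R : realType) (V : finType).
Implicit Types (w : {ffun V -> bool}) (f g : {ffun V -> bool} -> R).
Implicit Types (S : {set V}) (p : R) (Q : pred {ffun V -> bool}).

Definition bern p (b : bool) : R := if b then p else 1 - p.
Definition weight p w : R := \prod_v bern p (w v).
Definition mean p f : R := \sum_w weight p w * f w.
Definition prob p Q : R := mean p (fun w => (Q w)%:R).

Definition depends_on (T : Type) S (f : {ffun V -> bool} -> T) :=
  forall w w', {in S, w =1 w'} -> f w = f w'.

Definition nondecr f := forall w w', (forall v, w v ==> w' v) -> f w <= f w'.
Definition increasing_ev Q := forall w w', (forall v, w v ==> w' v) -> Q w -> Q w'.

Definition mix S w w' : {ffun V -> bool} := [ffun v => if v \in S then w v else w' v].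
Definition setv v b w : {ffun V -> bool} := [ffun u => if u == v then b else w u].

Lemma mean_prod p (h : V -> bool -> R) :
  mean p (fun w => \prod_v h v (w v)) =
  \prod_v (p * h v true + (1 - p) * h v false).
Proof.
transitivity (\prod_v \sum_b bern p b * h v b).
  rewrite bigA_distr_bigA /=; apply: eq_bigr => w _.
  by rewrite /weight big_split.
by apply: eq_bigr => v _; rewrite big_bool.
Qed.

Lemma eq_mean p f g : f =1 g -> mean p f = mean p g.
Proof. by move=> fg; apply: eq_bigr => w _; rewrite fg. Qed.

Lemma mean1 p : mean p (fun=> 1) = 1.
Proof.
transitivity (mean p (fun w => \prod_(v : V) 1)).
  by apply: eq_mean => w; rewrite big1.
rewrite (mean_prod p (fun _ _ => 1)) big1 // => v _.
by rewrite !mulr1 addrC subrK.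
Qed.

Lemma mean0 p : mean p (fun=> 0) = 0.
Proof. by rewrite /mean big1 // => w _; rewrite mulr0. Qed.

Lemma meanZ p c f : mean p (fun w => c * f w) = c * mean p f.
Proof. by rewrite /mean mulr_sumr; apply: eq_bigr => w _; rewrite mulrCA. Qed.

Lemma meanD p f g : mean p (fun w => f w + g w) = mean p f + mean p g.
Proof. by rewrite /mean -big_split; apply: eq_bigr => w _; rewrite mulrDr. Qed.

Lemma meanB p f g : mean p (fun w => f w - g w) = mean p f - mean p g.
Proof. by rewrite /mean -sumrB; apply: eq_bigr => w _; rewrite mulrBr. Qed.

Lemma mean_sum p (I : Type) (r : seq I) (P : pred I) (F : I -> {ffun V -> bool} -> R) :
  mean p (fun w => \sum_(i <- r | P i) F i w) = \sum_(i <- r | P i) mean p (F i).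
Proof.
by rewrite /mean exchange_big; apply: eq_bigr => w _; rewrite mulr_sumr.
Qed.

Section Unit.
Variable p : R.
Hypothesis p01 : 0 <= p <= 1.

Lemma bern_ge0 b : 0 <= bern p b.
Proof. by case: b; case/andP: p01 => ? ?; rewrite /bern ?subr_ge0. Qed.

Lemma weight_ge0 w : 0 <= weight p w.
Proof. by apply: prodr_ge0 => v _; apply: bern_ge0. Qed.

Lemma le_mean f g : (forall w, f w <= g w) -> mean p f <= mean p g.
Proof. by move=> fg; apply: ler_sum => w _; apply: ler_wpM2l => //; apply: weight_ge0. Qed.

Lemma mean_ge0 f : (forall w, 0 <= f w) -> 0 <= mean p f.
Proof. by move=> f0; apply: sumr_ge0 => w _; rewrite mulr_ge0 // weight_ge0. Qed.

Lemma prob_ge0 Q : 0 <= prob p Q.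
Proof. by apply: mean_ge0 => w; rewrite ler0n. Qed.

Lemma le_prob Q Q' : (forall w, Q w -> Q' w) -> prob p Q <= prob p Q'.
Proof.
by move=> QQ'; apply: le_mean => w; rewrite ler_nat leq_b1 || case: (Q w) (QQ' w) => // ->.
Qed.

Lemma prob_le1 Q : prob p Q <= 1.
Proof. by rewrite -(mean1 p); apply: le_mean => w; rewrite lern1 leq_b1. Qed.

Lemma prob_exists (I : finType) (P : pred I) (Q : I -> pred {ffun V -> bool}) :
  prob p (fun w => [exists i, P i && Q i w]) <= \sum_(i | P i) prob p (Q i).
Proof.
rewrite /prob -mean_sum; apply: le_mean => w.
case: existsP => [[i /andP[Pi Qi]]|_]; last by apply: sumr_ge0 => i _; rewrite ler0n.
by rewrite (bigD1 i) //= Qi lerDl; apply: sumr_ge0 => j _; rewrite ler0n.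
Qed.

End Unit.

Lemma eq_prob p Q Q' : Q =1 Q' -> prob p Q = prob p Q'.
Proof. by move=> QQ'; apply: eq_mean => w; rewrite QQ'. Qed.

(** Exchanging two independent samples off [S] preserves their joint law. *)
Lemma mean_indep p S f g : depends_on S f -> depends_on (~: S) g ->
  mean p (fun w => f w * g w) = mean p f * mean p g.
Proof.
move=> fS gS; symmetry.
pose sw (x : {ffun V -> bool} * {ffun V -> bool}) := (mix S x.1 x.2, mix S x.2 x.1).
have swK : involutive sw.
  move=> [a b]; rewrite /sw /=; congr pair; apply/ffunP => v; rewrite !ffunE;
  by case: (v \in S).
rewrite /mean big_distrlr pair_bigA /=.
rewrite (reindex_inj (inv_inj swK)) /=.
transitivity (\sum_(x : {ffun V -> bool} * {ffun V -> bool})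
   (weight p x.1 * (f x.1 * g x.1)) * weight p x.2).
  apply: eq_bigr => -[a b] _; rewrite /sw /=.
  have -> : f (mix S a b) = f a by apply: fS => v vS; rewrite ffunE vS.
  have -> : g (mix S b a) = g a.
    by apply: gS => v; rewrite inE ffunE => /negbTE ->.
  have E : weight p (mix S a b) * weight p (mix S b a) = weight p a * weight p b.
    rewrite /weight -!big_split; apply: eq_bigr => v _ /=; rewrite !ffunE.
    by case: (v \in S) => //=; apply: mulrC.
  by rewrite mulrACA E mulrAC.
rewrite -(pair_bigA _ (fun a b => weight p a * (f a * g a) * weight p b)) /=.
apply: eq_bigr => a _; rewrite -mulr_sumr.
have := mean1 p; rewrite /mean; under eq_bigr do rewrite mulr1.
by move=> ->; rewrite mulr1.
Qed.

Lemma mean_site p v (h : bool -> R) :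
  mean p (fun w => h (w v)) = p * h true + (1 - p) * h false.
Proof.
transitivity (mean p (fun w => \prod_u (if u == v then h (w u) else 1))).
  by apply: eq_mean => w; rewrite -big_mkcond big_pred1_eq.
rewrite (mean_prod p (fun u b => if u == v then h b else 1)).
rewrite (bigD1 v) //= eqxx big1 ?mulr1 // => u /negbTE ->.
by rewrite !mulr1 addrC subrK.
Qed.

Lemma mean_split p v f :
  mean p f = p * mean p (fun w => f (setv v true w)) + (1 - p) * mean p (fun w => f (setv v false w)).
Proof.
have dep b : depends_on (~: [set v]) (fun w => f (setv v b w)).
  move=> w w' ww'; congr f; apply/ffunP => u; rewrite !ffunE.
  by case: eqP => // /eqP uv; apply: ww'; rewrite !inE.
have depv (h : bool -> R) : depends_on [set v] (fun w : {ffun V -> bool} => h (w v)).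
  by move=> w w' ww'; rewrite ww' ?inE.
transitivity (mean p (fun w => (w v)%:R * f (setv v true w) + (~~ w v)%:R * f (setv v false w))).
  apply: eq_mean => w.
  have E : setv v (w v) w = w by apply/ffunP => u; rewrite ffunE; case: eqP => // ->.
  by case: (w v) E => /= ->; rewrite mul1r mul0r ?addr0 ?add0r.
rewrite meanD (mean_indep p (depv (fun b => b%:R)) (dep true)).
rewrite (mean_indep p (depv (fun b => (~~ b)%:R)) (dep false)).
by rewrite (mean_site p v (fun b => b%:R)) (mean_site p v (fun b => (~~ b)%:R)) /= !mulr1 !mulr0 addr0 add0r.
Qed.

(** Harris' inequality, by induction on the set of coordinates that matter: given
    one of them, both functions have conditional means that increase with it. *)
Lemma harris p f g : 0 <= p <= 1 -> nondecr f -> nondecr g ->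
  mean p f * mean p g <= mean p (fun w => f w * g w).
Proof.
move=> p01; have /andP[p0 p1] := p01.
suff H n S : #|S| = n -> forall f g, depends_on S f -> depends_on S g ->
    nondecr f -> nondecr g -> mean p f * mean p g <= mean p (fun w => f w * g w).
  by move=> fi gi; apply: (H _ (finset.setT) erefl) => // w w' ww'; congr (_ _);
    apply/ffunP => v; apply: ww'; rewrite inE.
elim: n S => [|n IH] S cS {}f {}g fS gS fi gi.
  move/cards0_eq: cS => S0; pose w0 : {ffun V -> bool} := [ffun=> true].
  have Ef w : f w = f w0 * 1 by rewrite mulr1; apply: fS => v; rewrite S0 inE.
  have Eg w : g w = g w0 * 1 by rewrite mulr1; apply: gS => v; rewrite S0 inE.
  rewrite (eq_mean p Ef) (eq_mean p Eg) !meanZ mean1.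
  rewrite (@eq_mean p _ (fun w => (f w0 * g w0) * 1)) ?meanZ ?mean1 ?mulr1 // => w.
  by rewrite (Ef w) (Eg w) !mulr1.
have [v vS] : exists v, v \in S by apply/set0Pn; rewrite -card_gt0 cS.
have cS' : #|S :\ v| = n by move: cS; rewrite (cardsD1 v) vS => -[].
have dep b h : depends_on S h -> depends_on (S :\ v) (fun w => h (setv v b w) : R).
  move=> hS w w' ww'; apply: hS => u uS; rewrite !ffunE.
  by case: eqP => // /eqP uv; apply: ww'; rewrite !inE uv.
have inc b h : nondecr h -> nondecr (fun w => h (setv v b w)).
  by move=> hi w w' ww'; apply: hi => u; rewrite !ffunE; case: eqP => //; case: b.
have step h : nondecr h -> mean p (fun w => h (setv v false w)) <= mean p (fun w => h (setv v true w)).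
  by move=> hi; apply: le_mean => // w; apply: hi => u; rewrite !ffunE; case: eqP => //; rewrite ?implybb.
rewrite (mean_split p v f) (mean_split p v g) (mean_split p v (fun w => f w * g w)).
have H1 := IH _ cS' _ _ (dep true _ fS) (dep true _ gS) (inc true _ fi) (inc true _ gi).
have H0 := IH _ cS' _ _ (dep false _ fS) (dep false _ gS) (inc false _ fi) (inc false _ gi).
have := step _ fi; have := step _ gi; move: H1 H0.
set F1 := mean p (fun w => f (setv v true w)); set F0 := mean p (fun w => f (setv v false w)).
set G1 := mean p (fun w => g (setv v true w)); set G0 := mean p (fun w => g (setv v false w)).
set M1 := mean p _; set M0 := mean p _ => H1 H0 Hg Hf.
have q0 : 0 <= 1 - p by rewrite subr_ge0.
apply: (@le_trans _ _ (p * (F1 * G1) + (1 - p) * (F0 * G0))); last first.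
  by apply: lerD; apply: ler_wpM2l.
have : 0 <= (p * (1 - p)) * ((F1 - F0) * (G1 - G0)) by rewrite !mulr_ge0 ?subr_ge0.
nra.
Qed.

Lemma harris_prob p Q Q' : 0 <= p <= 1 -> increasing_ev Q -> increasing_ev Q' ->
  prob p Q * prob p Q' <= prob p (fun w => Q w && Q' w).
Proof.
move=> p01 Qi Qi'; have inc Z : increasing_ev Z -> nondecr (fun w => (Z w)%:R).
  by move=> Zi w w' ww'; rewrite ler_nat; case: (Z w) (Zi _ _ ww') => // ->.
apply: le_trans (harris p01 (inc _ Qi) (inc _ Qi')) _.
by rewrite le_eqVlt; apply/orP; left; apply/eqP/eq_mean => w; rewrite -natrM mulnb.
Qed.

Lemma prob_cylinder p (K L : {set V}) : [disjoint K & L] ->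
  prob p (fun w => [forall v in K, w v] && [forall v in L, ~~ w v]) = p ^+ #|K| * (1 - p) ^+ #|L|.
Proof.
move=> KL.
transitivity (mean p (fun w => \prod_v (((v \in K) ==> w v) && ((v \in L) ==> ~~ w v))%:R)).
  apply: eq_mean => w.
  case: (boolP (_ && _)) => [/andP[/forallP HK /forallP HL]|H].
    by rewrite big1 // => v _; rewrite HK HL.
  suff /existsP[v /negbTE Hv] :
    [exists v, ~~ (((v \in K) ==> w v) && ((v \in L) ==> ~~ w v))].
    by rewrite (bigD1 v) //= Hv mul0r.
  rewrite -negb_forall; apply: contra H => /forallP H; apply/andP; split;
  by apply/forallP => v; have /andP[] := H v.
rewrite (mean_prod p (fun v b => (((v \in K) ==> b) && ((v \in L) ==> ~~ b))%:R)).
have pw (x : R) (A : {set V}) : x ^+ #|A| = \prod_v (if v \in A then x else 1).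
  by rewrite -prodr_const big_mkcond.
rewrite !pw -big_split /=.
apply: eq_bigr => v _; have := disjointFr KL (x:=v).
case: (v \in K) => [/(_ isT) -> |_] /=; rewrite ?mulr1 ?mulr0 ?addr0 //.
by case: (v \in L); rewrite /= ?mulr1 ?mulr0 ?add0r ?mul1r // addrC subrK.
Qed.

End ProductMeasure.

Lemma mean_bij (R : realType) (V : finType) (p : R) (k : V -> V) (f : {ffun V -> bool} -> R) :
  injective k -> mean p (fun w => f [ffun v => w (k v)]) = mean p f.
Proof.
move=> kI; rewrite [RHS]/mean.
pose c (w : {ffun V -> bool}) : {ffun V -> bool} := [ffun v => w (k v)].
pose c' (w : {ffun V -> bool}) : {ffun V -> bool} := [ffun v => w (invF kI v)].
have cK : cancel c' c by move=> w; apply/ffunP => v; rewrite !ffunE invF_f.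
have c'K : cancel c c' by move=> w; apply/ffunP => v; rewrite !ffunE f_invF.
rewrite (reindex c) /=; last by exists c' => w _; [apply: c'K|apply: cK].
apply: eq_bigr => w _; congr (_ * _).
rewrite /weight (reindex_inj kI) /=; apply: eq_bigr => v _; by rewrite ffunE.
Qed.

(** * Clusters *)

Section Clusters.
Context (V : finType) (e : rel V).
Hypothesis e_sym : symmetric e.
Implicit Types (w : {ffun V -> bool}) (A K S : {set V}) (x y z u v : V).

Definition open_in w A v := w v && (v \in A).

Definition open_edge w A u v := [&& open_in w A u, open_in w A v & e u v].

Definition conn w A x y := open_in w A x && connect (open_edge w A) x y.

Definition cluster w A x : {set V} := [set y | conn w A x y].

Definition outer_boundary A K : {set V} :=
  [set v in A | (v \notin K) && [exists u in K, e u v]].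

Definition inner_boundary A : {set V} := [set v in A | [exists u, (u \notin A) && e v u]].

Lemma conn_refl w A x : open_in w A x -> conn w A x x.
Proof. by move=> ox; rewrite /conn ox connect0. Qed.

Lemma conn_trans w A x y z : conn w A x y -> conn w A y z -> conn w A x z.
Proof. by move=> /andP[ox xy] /andP[_ yz]; rewrite /conn ox (connect_trans xy yz). Qed.

Lemma open_edge_sym w A : symmetric (open_edge w A).
Proof. by move=> u v; rewrite /open_edge e_sym andbCA. Qed.

Lemma conn_openl w A x y : conn w A x y -> open_in w A x.
Proof. by case/andP. Qed.

Lemma conn_openr w A x y : conn w A x y -> open_in w A y.
Proof.
case/andP => ox /connectP[s ps ->]; elim: s x ox ps => //= z s IH x ox.
by case/andP => /and3P[_ oz _]; apply: IH.
Qed.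

Lemma conn_sym w A x y : conn w A x y -> conn w A y x.
Proof.
move=> xy; rewrite /conn (conn_openr xy) (sym_connect_sym (@open_edge_sym w A)).
by case/andP: xy.
Qed.

Lemma conn1 w A x y : open_in w A x -> open_in w A y -> e x y -> conn w A x y.
Proof.
move=> ox oy exy; apply/andP; split => //.
by apply: connect1; rewrite /open_edge ox oy.
Qed.

Lemma conn_mono w w' A A' x y :
  (forall v, open_in w A v -> open_in w' A' v) -> conn w A x y -> conn w' A' x y.
Proof.
move=> sub /andP[ox xy]; rewrite /conn sub //=.
apply: (connect_sub _ xy) => u v /and3P[ou ov euv].
by apply: connect1; rewrite /open_edge !sub.
Qed.

Lemma conn_subset w A A' x y : A \subset A' -> conn w A x y -> conn w A' x y.
Proof.
move=> sAA'; apply: conn_mono => v; rewrite /open_in => /andP[-> vA] /=.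
exact: (fintype.subsetP sAA').
Qed.

Lemma conn_depends A x y : depends_on A (fun w => conn w A x y).
Proof.
move=> w w' ww'; apply/idP/idP; apply: conn_mono => v; rewrite /open_in => /andP[wv vA];
by rewrite vA andbT ?ww' // -ww'.
Qed.

Lemma conn_increasing A x y : increasing_ev (fun w => conn w A x y).
Proof.
move=> w w' ww'; apply: conn_mono => v; rewrite /open_in => /andP[wv ->].
by rewrite andbT; apply: implyP wv.
Qed.

Lemma connPath w A x y : conn w A x y <->
  exists s, [/\ path e x s, last x s = y & forall z, z \in x :: s -> open_in w A z].
Proof.
split.
  case/andP => ox /connectP[s ps ->]; exists s; split => //.
    by apply: sub_path ps => u v /and3P[].
  elim: s x ox ps => [|z s IH] x ox /=; first by move=> _ z; rewrite inE => /eqP ->.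
  case/andP => /and3P[_ oz _] ps t; rewrite inE => /predU1P[->//|]; exact: IH.
case=> s [ps <- os]; elim: s x ps os => [|z s IH] x /=.
  by move=> _ os; apply: conn_refl; apply: os; rewrite inE.
case/andP=> exz ps os.
have oz : open_in w A z by apply: os; rewrite !inE eqxx orbT.
have ox : open_in w A x by apply: os; rewrite inE eqxx.
apply: conn_trans (conn1 ox oz exz) _; apply: IH => // t ts.
by apply: os; rewrite inE ts orbT.
Qed.

(** Cutting a path at its first step out of [K] keeps the beginning inside [K].
    Applied to the complement of [K] and to the reversed path, it cuts at the
    last visit to [K]. *)
Lemma conn_exit w A K x y : x \in K -> y \notin K -> conn w A x y ->
  exists u v, [/\ u \in K, v \notin K, e u v, conn w (A :&: K) x u & conn w A v y].
Proof.
move=> xK yK /connPath[s [ps sy os]].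
elim: s x xK ps sy os => [|z s IH] x xK /=.
  by move=> _ xy; rewrite -xy xK in yK.
case/andP=> exz ps sy os.
have ox : open_in w (A :&: K) x.
  by have := os x; rewrite !inE eqxx /open_in inE xK andbT => /(_ isT).
have zy : conn w A z y.
  by apply/connPath; exists s; split => // t ts; apply: os; rewrite inE ts orbT.
have [zK|zK] := boolP (z \in K); last first.
  by exists x, z; split => //; apply: conn_refl.
have [|u [v [uK vK euv zu vy]]] := IH z zK ps sy.
  by move=> t ts; apply: os; rewrite inE ts orbT.
exists u, v; split => //; apply: (conn_trans _ zu); apply: conn1 => //.
exact: conn_openl zu.
Qed.

Lemma clusterP w A x y : (y \in cluster w A x) = conn w A x y.
Proof. by rewrite inE. Qed.

Lemma cluster_eq w A x y : conn w A x y -> cluster w A y = cluster w A x.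
Proof.
move=> xy; apply/setP => z; rewrite !clusterP; apply/idP/idP.
  exact: conn_trans.
by apply: conn_trans; apply: conn_sym.
Qed.

Lemma outer_boundary_closed w A x v : v \in outer_boundary A (cluster w A x) -> ~~ w v.
Proof.
rewrite inE => /and3P[vA vC /existsP[u /andP[uC euv]]].
apply: contra vC => wv; rewrite clusterP.
apply: conn_trans (conn1 _ _ euv); first by rewrite -clusterP.
  by apply: (@conn_openr _ _ x); rewrite -clusterP.
by rewrite /open_in wv.
Qed.

(** The possible clusters of [x] in [A]: those attained when exactly the sites of
    [K] are open. *)
Definition cluster_shape A x K := (x \in K) && (cluster [ffun v => v \in K] A x == K).

(** Connectivity inside [K] is a property of [K] alone, so being the cluster of
    [x] only prescribes the states of [K] and of its outer boundary. *)
Lemma cluster_shapeP w A x K : x \in K ->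
  (cluster w A x == K) =
  [&& cluster_shape A x K, [forall v in K, w v] & [forall v in outer_boundary A K, ~~ w v]].
Proof.
move=> xK; apply/eqP/and3P => [CK|[/andP[_ /eqP CK] /forallP Ko /forallP Kc]].
  split.
  - rewrite /cluster_shape xK; apply/eqP/setP => y; rewrite clusterP; apply/idP/idP.
      by move=> /conn_openr; rewrite /open_in ffunE => /andP[].
    rewrite -{1}CK clusterP => /connPath[s [ps sy os]].
    apply/connPath; exists s; split => // z zs; rewrite /open_in ffunE -CK clusterP.
    have /andP[_ ->] := os z zs; rewrite andbT.
    case/splitPl: zs ps os {sy} => s1 s2 <- ps os.
    apply/connPath; exists s1; split => //.
      by move: ps; rewrite cat_path => /andP[].
    by move=> t ts; apply: os; move: ts; rewrite !inE mem_cat => /orP[->|->]; rewrite ?orbT.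
  - apply/forallP => v; apply/implyP; rewrite -CK clusterP => /conn_openr.
    by case/andP.
  - apply/forallP => v; apply/implyP; rewrite -CK; exact: outer_boundary_closed.
apply/setP => y; apply/idP/idP; last first.
  rewrite -{1}CK !clusterP; apply: conn_mono => v; rewrite /open_in ffunE => /andP[vK ->].
  by rewrite andbT; apply: (implyP (Ko v)).
rewrite clusterP => xy; apply/negPn/negP => yK.
have [u [v [uK vK euv xu vy]]] := conn_exit xK yK xy.
have /andP[wv vA] := conn_openl vy.
suff vB : v \in outer_boundary A K by have := Kc v; rewrite vB wv.
by rewrite inE vA vK; apply/existsP; exists u; rewrite uK.
Qed.

Lemma disjoint_outer_boundary A K : [disjoint K & outer_boundary A K].
Proof. by apply/pred0P => v /=; rewrite inE; case: (v \in K); rewrite ?andbF. Qed.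

Section Law.
Context (R : realType).
Implicit Types (p : R) (F : {set V} -> R).

Lemma prob_cluster p A x K : cluster_shape A x K ->
  prob p (fun w => cluster w A x == K) = p ^+ #|K| * (1 - p) ^+ #|outer_boundary A K|.
Proof.
move=> shK; have /andP[xK _] := shK.
rewrite -(prob_cylinder p (disjoint_outer_boundary A K)).
by apply: eq_prob => w; rewrite cluster_shapeP // shK.
Qed.

Lemma cluster_shape_cluster w A x : open_in w A x -> cluster_shape A x (cluster w A x).
Proof.
move=> ox; have xC : x \in cluster w A x by rewrite clusterP conn_refl.
by have := cluster_shapeP w A xC; rewrite eqxx => /esym/and3P[].
Qed.

(** The shapes do not depend on [p]: this is what allows the comparison of two
    densities in [mean_tilt]. *)
Lemma mean_cluster p A x F :
  mean p (fun w => (open_in w A x)%:R * F (cluster w A x)) =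
  \sum_(K | cluster_shape A x K) p ^+ #|K| * (1 - p) ^+ #|outer_boundary A K| * F K.
Proof.
transitivity (mean p (fun w => \sum_(K | cluster_shape A x K) F K * (cluster w A x == K)%:R)).
  apply: eq_mean => w; case: (boolP (open_in w A x)) => [ox|nox] /=.
    rewrite (bigD1 (cluster w A x)) /=; last exact: cluster_shape_cluster.
    rewrite eqxx mul1r mulr1 big1 ?addr0 // => K /andP[_ /negbTE].
    by rewrite eq_sym => ->; rewrite mulr0.
  rewrite mul0r big1 // => K /andP[xK _].
  case: eqP => [CK|]; rewrite ?mulr0 //; move: xK; rewrite -CK clusterP.
  by move=> /conn_openl; rewrite (negbTE nox).
rewrite mean_sum; apply: eq_bigr => K shK; rewrite meanZ mulrC; congr (_ * _).
exact: prob_cluster.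
Qed.

End Law.
End Clusters.

(** * The two-arm estimate *)

Section Excess.
Context (R : realType).
Implicit Types (p q d D r x y : R).

(** Both bounds below follow from [exp (-t) <= 1 / (1 + t)] and are exact to first
    order. *)
Lemma expR_le_sub x : 0 <= x <= 2^-1 -> expR (- (x + 2 * x ^+ 2)) <= 1 - x.
Proof.
move=> /andP[x0 x2].
have pos : 0 < 1 + (x + 2 * x ^+ 2) by nra.
rewrite expRN; apply: (@le_trans _ _ (1 + (x + 2 * x ^+ 2))^-1).
  by rewrite lef_pV2 ?posrE ?expR_gt0 // expR_ge1Dx.
rewrite -div1r ler_pdivrMr //; nra.
Qed.

Lemma expR_le_add x : 0 <= x -> expR (x - x ^+ 2) <= 1 + x.
Proof.
move=> x0; have pos : 0 < 1 + - (x - x ^+ 2) by nra.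
rewrite -[x - _]opprK expRN; apply: (@le_trans _ _ (1 + - (x - x ^+ 2))^-1).
  by rewrite lef_pV2 ?posrE ?expR_gt0 // expR_ge1Dx.
rewrite -div1r ler_pdivrMr //; nra.
Qed.

(** Likelihood ratio of the densities [p - d] and [p] for a cluster of [a] sites
    whose outer boundary has [b] sites. *)
Definition tilt p d (a b : nat) : R := (1 - d / p) ^+ a * (1 + d / (1 - p)) ^+ b.

(** Second-order loss in [tilt_ge] when the boundary is at most [D] times as large
    as the cluster. *)
Definition curvature p D : R := 2 / p ^+ 2 + D / (1 - p) ^+ 2.

Lemma tilt_ge p d D (a b : nat) : 0 < p < 1 -> 0 < d <= p / 2 -> b%:R <= D * a%:R ->
  expR (d * (p * b%:R - (1 - p) * a%:R) / (p * (1 - p)) - d ^+ 2 * curvature p D * a%:R)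
    <= tilt p d a b.
Proof.
move=> /andP[p0 p1] /andP[d0 dp] bD; have q0 : 0 < 1 - p by rewrite subr_gt0.
have x0 : 0 <= d / p by rewrite divr_ge0 // ltW.
have x2 : d / p <= 2^-1 by rewrite ler_pdivrMr // mulrC.
have y0 : 0 <= d / (1 - p) by rewrite divr_ge0 // ltW.
apply: (@le_trans _ _ (expR (a%:R * (- (d / p + 2 * (d / p) ^+ 2))) *
   expR (b%:R * (d / (1 - p) - (d / (1 - p)) ^+ 2)))); last first.
  rewrite !expRM_natl; apply: ler_pM; rewrite ?exprn_ge0 ?expR_ge0 //.
    by apply: lerXn2r; rewrite ?nnegrE ?expR_ge0 ?expR_le_sub ?x0 // subr_ge0;
       apply: le_trans x2 _; rewrite invf_le1 ?ler1n.
  by apply: lerXn2r; rewrite ?nnegrE ?expR_ge0 ?expR_le_add ?addr_ge0.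
rewrite -expRD ler_expR.
have E : d ^+ 2 * (D / (1 - p) ^+ 2) * a%:R >= b%:R * (d / (1 - p)) ^+ 2.
  have -> : b%:R * (d / (1 - p)) ^+ 2 = (d / (1 - p)) ^+ 2 * b%:R by exact: mulrC.
  have -> : d ^+ 2 * (D / (1 - p) ^+ 2) * a%:R = (d / (1 - p)) ^+ 2 * (D * a%:R).
    by field; rewrite gt_eqF.
  by apply: ler_wpM2l => //; rewrite exprn_ge0.
rewrite /curvature.
have -> : d * (p * b%:R - (1 - p) * a%:R) / (p * (1 - p)) =
   b%:R * (d / (1 - p)) - a%:R * (d / p).
  by field; rewrite !gt_eqF.
have -> : d ^+ 2 * (2 / p ^+ 2 + D / (1 - p) ^+ 2) * a%:R =
  a%:R * (2 * (d / p) ^+ 2) + d ^+ 2 * (D / (1 - p) ^+ 2) * a%:R.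
  by field; rewrite !gt_eqF.
lra.
Qed.

(** An excess of closed sites per site that, divided by [p (1 - p)], is beyond
    [2 d * curvature] makes the exponent of [tilt_ge] at least half its linear
    term, and then [1 + t <= exp t] bounds the excess by the tilt. *)
Lemma excess_le_tilt p d D r (a b : nat) : 0 < p < 1 -> 0 < d <= p / 2 -> 0 <= D ->
  0 < r <= a%:R -> b%:R <= D * a%:R ->
  (p * b%:R - (1 - p) * a%:R) / a%:R <=
  p * (1 - p) * (2 * d * curvature p D + 2 / (r * d) * tilt p d a b).
Proof.
move=> pb db D0 /andP[r0 ra] bD; have Lge := tilt_ge pb db bD.
move: (pb) (db) => /andP[p0 p1] /andP[d0 dp]; have q0 : 0 < 1 - p by rewrite subr_gt0.
have a0 : 0 < a%:R :> R by apply: lt_le_trans ra.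
have pq0 : 0 < p * (1 - p) by rewrite mulr_gt0.
set L := tilt _ _ _ _ in Lge *; set K := curvature p D in Lge *.
pose g := (p * b%:R - (1 - p) * a%:R) / (p * (1 - p) * a%:R).
have -> : (p * b%:R - (1 - p) * a%:R) / a%:R = p * (1 - p) * g.
  by rewrite /g; field; rewrite !gt_eqF.
rewrite ler_pM2l //.
have E : d * (p * b%:R - (1 - p) * a%:R) / (p * (1 - p)) = a%:R * (d * g).
  by rewrite /g; field; rewrite !gt_eqF.
rewrite E in Lge.
have L0 : 0 <= L by apply: le_trans Lge; apply: expR_ge0.
have rd0 : 0 < r * d by rewrite mulr_gt0.
have [gs|gl] := lerP g (2 * d * K).
  by apply: ler_wpDr => //; rewrite mulr_ge0 // divr_ge0 // ltW.
apply: ler_wpDl.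
  have K0 : 0 <= K by rewrite /K /curvature addr_ge0 // divr_ge0 ?exprn_ge0 // ltW.
  by rewrite !mulr_ge0 // ltW.
have K0 : 0 <= K by rewrite /K /curvature addr_ge0 // divr_ge0 ?exprn_ge0 // ltW.
have g0 : 0 <= g by apply: le_trans (ltW gl); rewrite !mulr_ge0 // ltW.
rewrite mulrAC ler_pdivlMr //.
apply: (@le_trans _ _ (2 * expR (a%:R * (d * g) - d ^+ 2 * K * a%:R))); last by rewrite ler_pM2l.
apply: (@le_trans _ _ (2 * (1 + (a%:R * (d * g) - d ^+ 2 * K * a%:R)))); last first.
  by rewrite ler_pM2l // expR_ge1Dx.
have H1 : r * (d * g) <= a%:R * (d * g) by rewrite ler_wpM2r // mulr_ge0 // ltW.
have H2 : 2 * (d ^+ 2 * K * a%:R) <= a%:R * (d * g).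
  have : (d * a%:R) * (2 * d * K) <= (d * a%:R) * g by rewrite ler_pM2l ?mulr_gt0 // ltW.
  by move=> H; apply: le_trans (le_trans H _); rewrite le_eqVlt; apply/orP; left; apply/eqP; ring.
have -> : g * (r * d) = r * (d * g) by ring.
lra.
Qed.

End Excess.

Section TwoArms.
Context (V : finType) (e : rel V).
Hypothesis e_sym : symmetric e.
Implicit Types (w : {ffun V -> bool}) (A B K S : {set V}) (x y z u v : V).

Definition crossing w A B x := [exists b in B, conn e w A x b].

Definition two_arms w A B z :=
  [&& z \in A, ~~ w z & [exists u, exists u',
    [&& e u z, e u' z, crossing w A B u, crossing w A B u' & ~~ conn e w A u u']]].

Lemma crossing_open w A B x : crossing w A B x -> open_in w A x.
Proof. by case/existsP => b /andP[_ /conn_openl]. Qed.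

Lemma crossing_conn w A B x y : conn e w A x y -> crossing w A B x -> crossing w A B y.
Proof.
move=> xy /existsP[b /andP[bB xb]]; apply/existsP; exists b; rewrite bB.
exact: conn_trans (conn_sym e_sym xy) xb.
Qed.

Lemma crossing_cluster w A B x :
  crossing w A B x = open_in w A x && [exists b in B, b \in cluster e w A x].
Proof.
apply/idP/andP => [H|[_ /existsP[b /andP[bB bC]]]].
  split; first exact: crossing_open H.
  by case/existsP: H => b /andP[bB xb]; apply/existsP; exists b; rewrite bB clusterP.
by apply/existsP; exists b; rewrite bB -clusterP.
Qed.

Lemma crossing_increasing A B x : increasing_ev (fun w => crossing w A B x).
Proof.
move=> w w' ww' /existsP[b /andP[bB xb]]; apply/existsP; exists b; rewrite bB.
exact: conn_increasing ww' xb.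
Qed.

Lemma crossing_depends A B x : depends_on A (fun w => crossing w A B x).
Proof.
move=> w w' ww'; apply/existsP/existsP => -[b /andP[bB xb]]; exists b; rewrite bB.
  by rewrite -(@conn_depends _ e A x b _ _ ww').
by rewrite (@conn_depends _ e A x b _ _ ww').
Qed.

(** Cutting the path from [B] to [v] at its first visit to [v] leaves a path that
    does not use the opening of [v]. *)
Lemma reach_neighbor w A B v : v \notin B -> crossing (setv v true w) A B v ->
  v \in A /\ exists2 u, e u v & crossing w A B u.
Proof.
move=> vB /existsP[b /andP[bB vb]].
have vA : v \in A by case/andP: (conn_openl vb).
split=> //; have bv : b != v by apply: contraNneq vB => <-.
have bS : b \in ~: [set v] by rewrite !inE.
have vS : v \notin ~: [set v] by rewrite !inE eqxx.
have [u [v' [uS v'S euv bu _]]] := conn_exit bS vS (conn_sym e_sym vb).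
have v'v : v' = v by move: v'S; rewrite !inE negbK => /eqP.
exists u; first by rewrite -v'v.
apply/existsP; exists b; rewrite bB; apply: (conn_sym e_sym).
apply: conn_mono bu => t; rewrite /open_in ffunE !inE => /andP[wt /andP[-> tv]].
by move: wt; rewrite (negbTE tv) => ->.
Qed.

Section Count.
Context (R : realType).
Variable D : nat.
Hypothesis degree : forall u, (#|[set v | e u v]| <= D)%N.

Lemma card_outer_boundary A K : (#|outer_boundary e A K| <= D * #|K|)%N.
Proof.
rewrite -sum1_card.
apply: (@leq_trans (\sum_(v in outer_boundary e A K) \sum_(u in K) e u v)).
  apply: leq_sum => v; rewrite inE => /and3P[_ _ /existsP[u /andP[uK euv]]].
  by rewrite (bigD1 u) //= euv.
rewrite exchange_big /= mulnC -sum_nat_const; apply: leq_sum => u _.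
apply: leq_trans (degree u); rewrite -sum1_card big_mkcond [leqRHS]big_mkcond /=.
by apply: leq_sum => v _; rewrite !inE; case: (_ && _); case: (e u v).
Qed.

(** The number of crossing clusters that touch [v]: each cluster is counted through
    its sites, with total weight one. *)
Definition share w A B v : R :=
  \sum_(x | crossing w A B x && (v \in outer_boundary e A (cluster e w A x)))
    (#|cluster e w A x|%:R)^-1.

Lemma cluster_share w A B u v : crossing w A B u -> e u v -> v \in A -> ~~ w v ->
  forall x, x \in cluster e w A u ->
  [/\ crossing w A B x, cluster e w A x = cluster e w A u
    & v \in outer_boundary e A (cluster e w A x)].
Proof.
move=> cu euv vA wv x; rewrite clusterP => ux.
rewrite (cluster_eq e_sym ux); split=> //; first exact: crossing_conn ux cu.
rewrite inE vA clusterP /=; apply/andP; split.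
  by apply: contra wv => /conn_openr /andP[].
apply/existsP; exists u; by rewrite euv andbT clusterP conn_refl // (conn_openl ux).
Qed.

Lemma sum_cluster w A u : open_in w A u ->
  \sum_(x in cluster e w A u) (#|cluster e w A u|%:R)^-1 = 1 :> R.
Proof.
move=> ou; rewrite sumr_const -[LHS]mulr_natl divff // pnatr_eq0 -lt0n card_gt0.
by apply/finset.set0Pn; exists u; rewrite clusterP conn_refl.
Qed.

Lemma share_ge0 w A B v : 0 <= share w A B v.
Proof. by apply: sumr_ge0 => x _; rewrite invr_ge0 ler0n. Qed.

Lemma share_ge_sum w A B (v : V) (U : {set V}) :
  (forall x, x \in U -> crossing w A B x && (v \in outer_boundary e A (cluster e w A x))) ->
  \sum_(x in U) (#|cluster e w A x|%:R)^-1 <= share w A B v.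
Proof.
move=> sub; rewrite /share big_mkcond [leRHS]big_mkcond /=; apply: ler_sum => x _.
by case: ifPn => [/sub ->//|_]; case: ifP => // _; rewrite invr_ge0 ler0n.
Qed.

Lemma share_ge1 w A B u v : crossing w A B u -> e u v -> v \in A -> ~~ w v ->
  1 <= share w A B v.
Proof.
move=> cu euv vA wv; have H := cluster_share cu euv vA wv.
rewrite -[leLHS](sum_cluster (crossing_open cu)).
rewrite (eq_bigr (fun x => (#|cluster e w A x|%:R)^-1)); last by move=> x /H[_ ->].
by apply: share_ge_sum => // x /H[-> _ ->].
Qed.

Lemma share_ge2 w A B v : two_arms w A B v -> 2 <= share w A B v.
Proof.
case/and3P => vA wv /existsP[u /existsP[u' /and5P[eu eu' cu cu' uu']]].
have H := cluster_share cu eu vA wv; have H' := cluster_share cu' eu' vA wv.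
have dis : [disjoint cluster e w A u & cluster e w A u'].
  apply/pred0P => x /=; apply/negbTE; rewrite negb_and !clusterP.
  rewrite -implybE; apply/implyP => ux; apply: contra uu' => u'x.
  exact: conn_trans ux (conn_sym e_sym u'x).
have -> : 2 = \sum_(x in cluster e w A u) (#|cluster e w A u|%:R)^-1 +
  \sum_(x in cluster e w A u') (#|cluster e w A u'|%:R)^-1 :> R.
  by rewrite (sum_cluster (crossing_open cu)) (sum_cluster (crossing_open cu')).
rewrite (eq_bigr (fun x => (#|cluster e w A x|%:R)^-1)); last by move=> x /H[_ ->].
rewrite [X in _ + X](eq_bigr (fun x => (#|cluster e w A x|%:R)^-1)); last by move=> x /H'[_ ->].
rewrite -bigU //=.
rewrite (eq_bigl (fun x => x \in cluster e w A u :|: cluster e w A u')); last by move=> x; rewrite finset.in_setU.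
apply: share_ge_sum => // x; rewrite finset.in_setU => /orP[] xC.
  by have [-> _ ->] := H _ xC.
by have [-> _ ->] := H' _ xC.
Qed.

Definition reach w A B v := ~~ w v && crossing (setv v true w) A B v.

Lemma reach_two_arms_share w A B v : B \subset A ->
  (reach w A B v)%:R + (two_arms w A B v)%:R <= share w A B v + (v \in B)%:R.
Proof.
move=> BA; have := share_ge0 w A B v.
have [t|_] := boolP (two_arms w A B v).
  move=> _; have := share_ge2 t; case: (reach _ _ _ _); case: (v \in B) => /=; lra.
have [/andP[wv rv]|_] := boolP (reach w A B v); last by case: (v \in B) => /=; lra.
have [vB|vB] := boolP (v \in B); first by move=> /=; lra.
have [vA [u eu cu]] := reach_neighbor vB rv.
by have := share_ge1 cu eu vA wv => /=; lra.
Qed.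

Variable p : R.

(** Whether [v] crosses once it is opened does not depend on the state of [v]; this
    relates the density of crossing sites to that of the closed sites around
    them. *)
Lemma prob_crossing A B v : prob p (fun w => crossing w A B v) =
  p * prob p (fun w => crossing (setv v true w) A B v).
Proof.
rewrite [LHS](mean_split p v) [X in _ + X](_ : _ = 0) ?addr0.
  congr (_ * _); apply: eq_mean => w; congr (_%:R).
rewrite (@eq_mean _ _ _ _ (fun=> 0)) ?mean0 ?mulr0 // => w.
case E : (crossing _ _ _ _) => //; have /andP[] := crossing_open E.
by rewrite ffunE eqxx.
Qed.

Lemma prob_reach A B v : prob p (fun w => reach w A B v) =
  (1 - p) * prob p (fun w => crossing (setv v true w) A B v).
Proof.
rewrite [LHS](mean_split p v) [X in X + _](_ : _ = 0) ?add0r.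
  congr (_ * _); apply: eq_mean => w; congr (_%:R); rewrite /reach ffunE eqxx /=.
  by congr crossing; apply/ffunP => u; rewrite !ffunE; case: eqP.
rewrite (@eq_mean _ _ _ _ (fun=> 0)) ?mean0 ?mulr0 // => w.
by rewrite /reach ffunE eqxx.
Qed.

End Count.
End TwoArms.

Section TwoArmsSum.
Context (R : realType) (V : finType) (e : rel V).
Hypothesis e_sym : symmetric e.
Variables (D : nat) (p : R).
Hypothesis degree : forall u, (#|[set v | e u v]| <= D)%N.
Hypothesis p01 : 0 < p < 1.
Implicit Types (w : {ffun V -> bool}) (A B : {set V}) (x : V).

Let p01' : 0 <= p <= 1.
Proof. by case/andP: p01 => /ltW -> /ltW ->. Qed.

(** The tilted weights are the weights of the shapes at density [p - d], and these
    add up to a probability. *)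
Lemma mean_tilt A x d : 0 < d <= p / 2 ->
  mean p (fun w => (open_in w A x)%:R *
    tilt p d #|cluster e w A x| #|outer_boundary e A (cluster e w A x)|) <= 1.
Proof.
move=> /andP[d0 dp]; have /andP[p0 p1] := p01.
rewrite (mean_cluster e p A x (fun K => tilt p d #|K| #|outer_boundary e A K|)).
apply: (@le_trans _ _ (mean (p - d) (fun w => (open_in w A x)%:R * 1))).
  rewrite (mean_cluster e (p - d) A x (fun=> 1)) le_eqVlt; apply/orP; left; apply/eqP.
  apply: eq_bigr => K _; rewrite mulr1 /tilt mulrACA -!exprMn.
  have -> : p * (1 - d / p) = p - d by field; rewrite gt_eqF.
  by have -> : (1 - p) * (1 + d / (1 - p)) = 1 - (p - d) by field; rewrite gt_eqF ?subr_gt0.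
rewrite (@eq_mean _ _ _ _ (fun w => (open_in w A x)%:R)); last by move=> w; rewrite mulr1.
by apply: (@prob_le1 _ _ (p - d) _ (fun w => open_in w A x)); apply/andP; split; lra.
Qed.

Definition excess_const : R := p * (1 - p) * (p * curvature p D%:R + 4 / p).

(** Large clusters rarely have many more closed neighbours than the density [p]
    predicts: the relative excess is of the order of the inverse square root of
    the size. *)
Lemma mean_excess A B x (r : nat) : (0 < r)%N ->
  (forall w, crossing e w A B x -> (r <= #|cluster e w A x|)%N) ->
  mean p (fun w => (crossing e w A B x)%:R *
    ((p * #|outer_boundary e A (cluster e w A x)|%:R - (1 - p) * #|cluster e w A x|%:R)
       / #|cluster e w A x|%:R)) <= excess_const / Num.sqrt r%:R.
Proof.
move=> r0 hr; have /andP[p0 p1] := p01; have q0 : 0 < 1 - p by rewrite subr_gt0.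
have rr0 : 0 < r%:R :> R by rewrite ltr0n.
have s0 : 0 < Num.sqrt r%:R :> R by rewrite sqrtr_gt0.
have s1 : 1 <= Num.sqrt r%:R :> R by rewrite -{1}(sqrtr1 R) ler_sqrt ?ler1n.
pose s := Num.sqrt r%:R : R; have ss : s * s = r%:R by rewrite -expr2 sqr_sqrtr // ltW.
(* of order [r ^ (-1/2)], to balance the two terms of [excess_le_tilt] *)
have [d dE] : exists d, d = p / 2 / s by exists (p / 2 / s).
have db : 0 < d <= p / 2.
  rewrite dE !divr_gt0 //= ler_pdivrMr // ler_peMr // divr_ge0 //; exact: ltW.
have /andP[d0 dp] := db.
pose K0 := curvature p D%:R.
have K00 : 0 <= K0 by rewrite /K0 /curvature addr_ge0 // divr_ge0 ?exprn_ge0 // ltW.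
pose T w := tilt p d #|cluster e w A x| #|outer_boundary e A (cluster e w A x)|.
have T0 w : 0 <= T w.
  rewrite /T /tilt mulr_ge0 // exprn_ge0 //.
    rewrite subr_ge0 ler_pdivrMr // mul1r; lra.
  by rewrite addr_ge0 // divr_ge0 // ltW.
have rd0 : 0 <= 2 / (r%:R * d) by rewrite divr_ge0 // mulr_ge0 // ltW.
apply: (@le_trans _ _ (mean p (fun w => p * (1 - p) * ((2 * d * K0) * (open_in w A x)%:R +
   (2 / (r%:R * d)) * ((open_in w A x)%:R * T w))))).
  apply: le_mean => // w; case: (boolP (crossing _ _ _ _ _)) => cx.
    rewrite (crossing_open cx) !mul1r mulr1.
    apply: excess_le_tilt => //.
      by rewrite rr0 /= ler_nat hr.
    by rewrite -natrM ler_nat card_outer_boundary.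
  rewrite mul0r; apply: mulr_ge0; first by rewrite mulr_ge0 // ltW.
  apply: addr_ge0; apply: mulr_ge0; rewrite ?ler0n //.
    by rewrite !mulr_ge0 // ltW.
  by rewrite mulr_ge0 ?ler0n.
rewrite meanZ meanD !meanZ.
apply: (@le_trans _ _ (p * (1 - p) * (2 * d * K0 * 1 + 2 / (r%:R * d) * 1))).
  rewrite ler_pM2l ?mulr_gt0 //; apply: lerD; apply: ler_wpM2l => //.
  - by rewrite !mulr_ge0 // ltW.
  - by apply: (@prob_le1 _ _ p _ (fun w => open_in w A x)).
  - exact: mean_tilt.
rewrite /excess_const -/K0 -/s -ss dE le_eqVlt; apply/orP; left; apply/eqP.
by field; rewrite !gt_eqF.
Qed.

Lemma sum_share w A B :
  \sum_v share e R w A B v =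
  \sum_x (crossing e w A B x)%:R *
    (#|outer_boundary e A (cluster e w A x)|%:R / #|cluster e w A x|%:R).
Proof.
rewrite /share (exchange_big_dep (fun x => crossing e w A B x)) /=; last by move=> v x _ /andP[].
rewrite big_mkcond; apply: eq_bigr => x _; case: ifP => cx; last by rewrite mul0r.
rewrite (eq_bigl (fun v => v \in outer_boundary e A (cluster e w A x))); last by move=> v; rewrite cx.
by rewrite sumr_const mul1r -[LHS]mulr_natl.
Qed.

(** Counting of Aizenman, Kesten and Newman. The closed sites around the union of
    the crossing clusters balance the open sites of this union exactly in mean.
    Counted cluster by cluster, those with two arms appear at least twice, and
    the surplus is controlled by the excess of each cluster. *)
Lemma two_arms_sum A B (l : V -> nat) : B \subset A -> (forall x, (0 < l x)%N) ->
  (forall w x, crossing e w A B x -> (l x <= #|cluster e w A x|)%N) ->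
  p * (\sum_z prob p (fun w => two_arms e w A B z)) <=
  excess_const * (\sum_(x in A) (Num.sqrt (l x)%:R)^-1) + p * #|B|%:R.
Proof.
move=> BA l0 hl; have /andP[p0 p1] := p01; have q0 : 0 < 1 - p by rewrite subr_gt0.
pose N := \sum_v mean p (fun w => share e R w A B v).
pose X := \sum_v prob p (fun w => crossing e w A B v).
pose Y := \sum_v prob p (fun w => reach e w A B v).
(* [X] counts the crossing sites, [Y] the closed sites that would cross if opened *)
have XY : (1 - p) * X = p * Y.
  rewrite /X /Y !mulr_sumr; apply: eq_bigr => v _.
  by rewrite prob_crossing prob_reach mulrCA.
have H1 : Y + \sum_z prob p (fun w => two_arms e w A B z) <= N + #|B|%:R.
  have -> : #|B|%:R = \sum_v mean p (fun _ : {ffun V -> bool} => (v \in B)%:R) :> R.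
    rewrite -sumr_const big_mkcond /=; apply: eq_bigr => v _.
    case: (v \in B); last by rewrite mean0.
    by rewrite mean1.
  rewrite /Y /N -!big_split /=; apply: ler_sum => v _; rewrite /prob -!meanD.
  by apply: le_mean => // w; apply: reach_two_arms_share.
have H2 : p * N - (1 - p) * X <= excess_const * (\sum_(x in A) (Num.sqrt (l x)%:R)^-1).
  have -> : p * N - (1 - p) * X = \sum_x mean p (fun w => (crossing e w A B x)%:R *
    ((p * #|outer_boundary e A (cluster e w A x)|%:R - (1 - p) * #|cluster e w A x|%:R)
       / #|cluster e w A x|%:R)).
    rewrite /N -mean_sum (@eq_mean _ _ _ _ (fun w => \sum_x (crossing e w A B x)%:R *
    (#|outer_boundary e A (cluster e w A x)|%:R / #|cluster e w A x|%:R))); last first.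
      by move=> w; rewrite sum_share.
    rewrite mean_sum /X !mulr_sumr -sumrB; apply: eq_bigr => x _.
    rewrite /prob -!meanZ -meanB; apply: eq_mean => w.
    case: (boolP (crossing _ _ _ _ _)) => cx; last by rewrite !mul0r !mulr0 subr0.
    have C0 : #|cluster e w A x|%:R != 0 :> R.
      rewrite pnatr_eq0 -lt0n; exact: leq_trans (l0 x) (hl _ _ cx).
    by field.
  rewrite mulr_sumr [leRHS]big_mkcond /=; apply: ler_sum => x _.
  case: ifPn => xA; first by apply: mean_excess => // w; apply: hl.
  rewrite (@eq_mean _ _ _ _ (fun=> 0)) ?mean0 // => w.
  case E : (crossing _ _ _ _ _); last by rewrite mul0r.
  by have /andP[_] := crossing_open E; rewrite (negbTE xA).
have H3 : p * (Y + \sum_z prob p (fun w => two_arms e w A B z)) <= p * (N + #|B|%:R).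
  by rewrite ler_pM2l.
move: H3; rewrite !mulrDr -XY; lra.
Qed.
End TwoArmsSum.

(** * Joining two arms *)

Section Linking.
Context (R : realType) (V : finType) (e : rel V).
Hypothesis e_sym : symmetric e.
Variable p : R.
Hypothesis p01 : 0 <= p <= 1.
Implicit Types (w : {ffun V -> bool}) (A B K Q : {set V}) (x y u v : V).

(** A path stays in the cluster of its origin; hence paths from [y] avoid the hull
    of a cluster that does not contain [y]. *)
Lemma conn_in_cluster w A x y : conn e w A x y -> conn e w (A :&: cluster e w A x) x y.
Proof.
move=> xy; have ox := conn_openl xy.
have oC z : conn e w A x z -> open_in w (A :&: cluster e w A x) z.
  by move=> xz; have /andP[wz zA] := conn_openr xz; rewrite /open_in wz inE zA clusterP.
have sub := @conn_subset _ e w _ _ _ _ (subsetIl A (cluster e w A x)).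
pose K := [set z | conn e w (A :&: cluster e w A x) x z].
have [yK|yK] := boolP (y \in K); first by move: yK; rewrite inE.
have xK : x \in K by rewrite inE conn_refl // oC // conn_refl.
have [u [v [uK vK euv _ vy]]] := conn_exit xK yK xy.
case/negP: vK; move: uK; rewrite !inE => xu.
apply: (conn_trans xu); apply: conn1 => //; first exact: conn_openr xu.
apply: oC; apply: conn_trans (sub _ _ xu) _; apply: conn1 => //.
  exact: conn_openr (sub _ _ xu).
exact: conn_openl vy.
Qed.

Definition separate w A B x y :=
  [&& crossing e w A B x, crossing e w A B y & ~~ conn e w A x y].

Definition hull A K := K :|: outer_boundary e A K.

Definition cylinder A K w :=
  [forall v in K, w v] && [forall v in outer_boundary e A K, ~~ w v].

Definition bridged A Q K y w :=
  [exists u in outer_boundary e A K :&: Q, exists u',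
     e u u' && conn e w (Q :&: ~: hull A K) u' y].

Lemma cylinder_depends A K : depends_on (hull A K) (cylinder A K).
Proof.
move=> w w' ww'; rewrite /cylinder; congr andb; apply: eq_forallb => v;
case: (boolP (v \in _)) => //= vK; by rewrite ww' // inE vK ?orbT.
Qed.

Lemma bridged_depends A Q K y : depends_on (~: hull A K) (bridged A Q K y).
Proof.
move=> w w' ww'; apply: eq_existsb => u; congr andb; apply: eq_existsb => u'; congr andb.
apply: conn_depends => v; rewrite inE => /andP[_]; exact: ww'.
Qed.

Lemma bridged_increasing A Q K y : increasing_ev (bridged A Q K y).
Proof.
move=> w w' ww' /existsP[u /andP[uB /existsP[u' /andP[euu' c]]]].
apply/existsP; exists u; rewrite uB; apply/existsP; exists u'; rewrite euu'.
exact: conn_increasing ww' c.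
Qed.

(** Seen from [y], the last step before the hull of [K] arrives at the outer
    boundary: a neighbour of [K] lies in the hull. *)
Lemma conn_bridged A Q K x y w : Q \subset A -> x \in K -> y \notin hull A K ->
  conn e w Q x y -> bridged A Q K y w.
Proof.
move=> QA xK yS xy.
have yS' : y \in ~: hull A K by rewrite inE.
have xS' : x \notin ~: hull A K by rewrite !inE xK.
have [u' [u [u'S uS eu'u yu' ux]]] := conn_exit yS' xS' (conn_sym e_sym xy).
have /andP[_ uQ] := conn_openl ux.
have /andP[_] := conn_openr yu'; rewrite inE => /andP[u'Q _].
apply/existsP; exists u; rewrite inE uQ andbT.
have -> /= : u \in outer_boundary e A K.
  move: uS; rewrite inE negbK finset.in_setU => /orP[uK|//].
  move: u'S; rewrite !inE negb_or => /andP[u'K /negP[]].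
  rewrite (fintype.subsetP QA) // u'K; apply/existsP; exists u; by rewrite uK e_sym.
by apply/existsP; exists u'; rewrite e_sym eu'u; apply: conn_sym.
Qed.

Lemma separate_cylinder w A B x y (K := cluster e w A x) : separate w A B x y ->
  [/\ cluster_shape e A x K, [exists b in B, b \in K], y \notin hull A K,
      cylinder A K w & crossing e w (A :&: ~: hull A K) B y].
Proof.
case/and3P => cx cy xy; have ox := crossing_open cx.
have xK : x \in K by rewrite clusterP conn_refl.
have off z : conn e w A y z -> z \notin hull A K.
  move=> yz; rewrite finset.in_setU negb_or clusterP; apply/andP; split.
    by apply: contra xy => xz; apply: conn_trans xz (conn_sym e_sym yz).
  apply/negP => /outer_boundary_closed; have /andP[-> _] := conn_openr yz; exact/negP/negPn.
split.
- exact: cluster_shape_cluster.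
- by move: cx; rewrite crossing_cluster => /andP[].
- by apply: off; apply: conn_refl; apply: crossing_open cy.
- by have := cluster_shapeP e w A xK; rewrite eqxx => /esym/and3P[_ H1 H2]; apply/andP.
- case/existsP: cy => b /andP[bB yb]; apply/existsP; exists b; rewrite bB.
  apply: conn_subset (conn_in_cluster yb); apply/fintype.subsetP => z.
  by rewrite !finset.in_setI clusterP finset.in_setC => /andP[-> /off].
Qed.

Lemma bridged_two_arms w A B Q K x y : Q \subset A -> cluster_shape e A x K ->
  [exists b in B, b \in K] -> cylinder A K w -> crossing e w (A :&: ~: hull A K) B y ->
  bridged A Q K y w -> [exists u in Q, two_arms e w A B u].
Proof.
move=> QA shK /existsP[b /andP[bB bK]] cyl cy /existsP[u /andP[]].
rewrite inE => /andP[uB uQ] /existsP[u' /andP[euu' u'y]].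
have xK : x \in K by case/andP: shK.
have CK : cluster e w A x = K.
  by apply/eqP; rewrite cluster_shapeP // shK; case/andP: cyl => -> ->.
have subA : A :&: ~: hull A K \subset A by apply: subsetIl.
have cu' : crossing e w A B u'.
  case/existsP: cy => b' /andP[b'B yb']; apply/existsP; exists b'; rewrite b'B.
  apply: conn_trans (conn_subset subA yb').
  apply: conn_subset u'y; apply: fintype.subset_trans (subsetIl _ _) QA.
move: (uB); rewrite inE => /and3P[uA _ /existsP[k /andP[kK eku]]].
have xk : conn e w A x k by rewrite -clusterP CK.
apply/existsP; exists u; rewrite uQ /two_arms uA /=; apply/andP; split.
  by case/andP: cyl => _ /forallP /(_ u); rewrite uB.
apply/existsP; exists k; apply/existsP; exists u'; rewrite eku e_sym euu' cu' /=.
apply/andP; split.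
  apply/existsP; exists b; rewrite bB; apply: conn_trans (conn_sym e_sym xk) _.
  by rewrite -clusterP CK.
apply/negP => ku'; have := conn_trans xk ku'; rewrite -clusterP CK => u'K.
by have /andP[_] := conn_openl u'y; rewrite !inE u'K andbF.
Qed.

(** Explore the cluster of [x]. The states off its hull remain independent, so
    there Harris' inequality makes [y] cross and be linked to the hull at once;
    the closed site where the link meets the hull then has two arms. *)
Lemma separate_conn_le A B Q x y : Q \subset A ->
  prob p (fun w => separate w A B x y) * prob p (fun w => conn e w Q x y) <=
  \sum_(u in Q) prob p (fun w => two_arms e w A B u).
Proof.
move=> QA.
pose Ks K := [&& cluster_shape e A x K, [exists b in B, b \in K] & y \notin hull A K].
pose f K w := crossing e w (A :&: ~: hull A K) B y.
pose c K w : R := (cylinder A K w)%:R.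
have fD K : depends_on (~: hull A K) (f K).
  move=> w w' ww'; apply: (@crossing_depends _ e) => v; rewrite inE => /andP[_]; exact: ww'.
have cD K : depends_on (hull A K) (c K).
  by move=> w w' ww'; rewrite /c (cylinder_depends ww').
have H1 : prob p (fun w => separate w A B x y) <= \sum_(K | Ks K) mean p (c K) * prob p (f K).
  under eq_bigr => K _.
    rewrite /prob -(mean_indep p (cD K)); last by move=> w w' ww'; rewrite (fD K _ _ ww').
    over.
  rewrite -mean_sum; apply: le_mean => // w.
  have ge0 K : 0 <= c K w * (f K w)%:R by rewrite mulr_ge0 // ler0n.
  case: (boolP (separate _ _ _ _ _)) => [/separate_cylinder[h1 h2 h3 h4 h5]|_]; last exact: sumr_ge0.
  rewrite (bigD1 (cluster e w A x)) /=; last by rewrite /Ks h1 h2.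
  by rewrite {1}/c h4 /f h5 mulr1 lerDl; apply: sumr_ge0.
apply: le_trans (ler_wpM2r (prob_ge0 p01 _) H1) _.
rewrite mulr_suml.
apply: (@le_trans _ _ (\sum_(K | Ks K) mean p (c K) * prob p (fun w => f K w && bridged A Q K y w))).
  apply: ler_sum => K /and3P[shK bK yS]; rewrite -mulrA; apply: ler_wpM2l.
    by apply: mean_ge0 => // w; rewrite ler0n.
  apply: (@le_trans _ _ (prob p (f K) * prob p (bridged A Q K y))).
    apply: ler_wpM2l; first exact: prob_ge0.
    by apply: le_prob => // w; apply: conn_bridged => //; case/andP: shK.
  apply: harris_prob => //; last exact: bridged_increasing.
  exact: crossing_increasing.
apply: le_trans (prob_exists p01 (fun u => u \in Q) (fun u w => two_arms e w A B u)).
under eq_bigr => K _.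
  rewrite /prob -(mean_indep p (cD K)); last first.
    by move=> w w' ww'; rewrite (fD K _ _ ww') (@bridged_depends A Q K y _ _ ww').
  over.
rewrite -mean_sum; apply: le_mean => // w.
have [/existsP[K0 /and3P[K0s K0c K0f]]|nK] :=
    boolP [exists K, [&& Ks K, cylinder A K w & f K w && bridged A Q K y w]]; last first.
  rewrite big1 ?ler0n // => K KK; apply/eqP; rewrite -natrM mulnb pnatr_eq0 eqb0.
  by apply: contra nK => H; apply/existsP; exists K; rewrite KK.
have /and3P[shK0 bK0 yS0] := K0s; have /andP[fK0 gK0] := K0f.
rewrite (bridged_two_arms QA shK0 bK0 K0c fK0 gK0).
have CK K : Ks K -> cylinder A K w -> K = cluster e w A x.
  move=> /and3P[shK _ _] cK; apply/esym/eqP; rewrite cluster_shapeP; last by case/andP: shK.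
  by rewrite shK; case/andP: cK => -> ->.
rewrite (bigD1 K0) //= big1 ?addr0.
  by rewrite -natrM mulnb lern1 leq_b1.
move=> K /andP[Ks' KK0]; apply/eqP; rewrite -natrM mulnb pnatr_eq0 eqb0 negb_and.
apply/orP; left; apply: contra KK0 => cK.
by rewrite (CK _ Ks' cK) (CK _ K0s K0c).
Qed.
End Linking.

(** * Symmetries and restriction to smaller sets *)

Section Maps.
Context (V V' : finType) (e : rel V) (e' : rel V').

Lemma conn_map (f : V -> V') (w : {ffun V -> bool}) (w' : {ffun V' -> bool})
    (A : {set V}) (A' : {set V'}) x y :
  (forall u v, open_in w A u -> open_in w A v -> e u v -> e' (f u) (f v)) ->
  (forall v, open_in w A v -> open_in w' A' (f v)) ->
  conn e w A x y -> conn e' w' A' (f x) (f y).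
Proof.
move=> fe fo /andP[ox /connectP[s ps ->]]; elim: s x ox ps => [|z s IH] x ox /=.
  by move=> _; apply: conn_refl; apply: fo.
case/andP => /and3P[_ oz exz] ps; apply: conn_trans (IH z oz ps).
by apply: conn1; rewrite ?fo ?fe.
Qed.
End Maps.

Section Symmetry.
Context (R : realType) (V : finType) (e : rel V) (f : V -> V) (A A' : {set V}) (p : R).
Hypothesis f_inj : injective f.
Hypothesis fe : forall u v, e (f u) (f v) = e u v.
Hypothesis fA : forall v, (f v \in A') = (v \in A).

Lemma conn_automorphism w x y :
  conn e w A' (f x) (f y) = conn e [ffun v => w (f v)] A x y.
Proof.
apply/idP/idP; last first.
  by apply: conn_map => [u v _ _|v]; rewrite ?fe // /open_in ffunE fA.
move=> c; rewrite -[x](invF_f f_inj) -[y](invF_f f_inj).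
apply: conn_map c => [u v _ _|v]; first by rewrite -(fe (invF f_inj u)) !f_invF.
by rewrite /open_in ffunE f_invF -fA f_invF.
Qed.

Lemma prob_conn_automorphism x y :
  prob p (fun w => conn e w A' (f x) (f y)) = prob p (fun w => conn e w A x y).
Proof.
rewrite -[RHS](mean_bij p _ f_inj); apply: eq_prob => w; exact: conn_automorphism.
Qed.

Lemma inner_boundary_automorphism v :
  (f v \in inner_boundary e A') = (v \in inner_boundary e A).
Proof.
rewrite !inE fA; congr andb; apply/existsP/existsP => -[u /andP[uA evu]].
  by exists (invF f_inj u); rewrite -fA -fe f_invF uA.
by exists (f u); rewrite fA fe uA.
Qed.

Lemma crossing_automorphism w x :
  crossing e w A' (inner_boundary e A') (f x) =
  crossing e [ffun v => w (f v)] A (inner_boundary e A) x.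
Proof.
apply/existsP/existsP => -[b /andP[bB xb]].
  exists (invF f_inj b); rewrite -inner_boundary_automorphism -conn_automorphism f_invF.
  by rewrite bB.
by exists (f b); rewrite inner_boundary_automorphism conn_automorphism bB.
Qed.

Lemma prob_crossing_automorphism x :
  prob p (fun w => crossing e w A' (inner_boundary e A') (f x)) =
  prob p (fun w => crossing e w A (inner_boundary e A) x).
Proof.
rewrite -[RHS](mean_bij p _ f_inj); apply: eq_prob => w; exact: crossing_automorphism.
Qed.

Lemma two_arms_automorphism w x :
  two_arms e w A' (inner_boundary e A') (f x) =
  two_arms e [ffun v => w (f v)] A (inner_boundary e A) x.
Proof.
rewrite /two_arms fA ffunE; congr [&& _, _ & _].
apply/existsP/existsP => -[u /existsP[u' H]].
  exists (invF f_inj u); apply/existsP; exists (invF f_inj u').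
  by rewrite -fe -(fe (invF _ u')) -!crossing_automorphism -conn_automorphism !f_invF.
exists (f u); apply/existsP; exists (f u').
by rewrite !fe !crossing_automorphism conn_automorphism.
Qed.

Lemma prob_two_arms_automorphism x :
  prob p (fun w => two_arms e w A' (inner_boundary e A') (f x)) =
  prob p (fun w => two_arms e w A (inner_boundary e A) x).
Proof.
rewrite -[RHS](mean_bij p _ f_inj); apply: eq_prob => w; exact: two_arms_automorphism.
Qed.

End Symmetry.

Section Shrink.
Context (V : finType) (e : rel V).
Implicit Types (w : {ffun V -> bool}) (A : {set V}).

(** A path that leaves [A'] does so through the boundary of [A']. *)
Lemma crossing_shrink w A (A' : {set V}) x : A' \subset A -> x \in A' ->
  crossing e w A (inner_boundary e A) x -> crossing e w A' (inner_boundary e A') x.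
Proof.
move=> sub xA' /existsP[b /andP[bB xb]].
pose K := [set z | conn e w A' x z].
have ox : open_in w A' x.
  by have /andP[wx _] := conn_openl xb; rewrite /open_in wx.
have xK : x \in K by rewrite inE conn_refl.
have [bK|bK] := boolP (b \in K).
  apply/existsP; exists b; move: (bK); rewrite inE => ->; rewrite andbT.
  have /andP[_ bA'] : open_in w A' b by apply: (@conn_openr _ e _ _ x); move: bK; rewrite inE.
  move: bB; rewrite !inE bA' => /andP[_ /existsP[u /andP[uA ebu]]].
  by apply/existsP; exists u; rewrite ebu andbT; apply: contra uA; apply: (fintype.subsetP sub).
have [u [v [uK vK euv _ vb]]] := conn_exit xK bK xb.
move: uK; rewrite inE => xu; apply/existsP; exists u; rewrite xu andbT inE.
have /andP[_ ->] := conn_openr xu; apply/existsP; exists v; rewrite euv andbT.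
apply: contra vK => vA'; rewrite inE; apply: (conn_trans xu); apply: conn1 euv.
  exact: conn_openr xu.
by rewrite /open_in vA' andbT; case/andP: (conn_openl vb).
Qed.

Lemma two_arms_shrink w A (A' : {set V}) x : A' \subset A -> x \in A' ->
  (forall u, e u x -> u \in A') ->
  two_arms e w A (inner_boundary e A) x -> two_arms e w A' (inner_boundary e A') x.
Proof.
move=> sub xA' nA' /and3P[_ wx /existsP[u /existsP[u' /and5P[eu eu' cu cu' uu']]]].
rewrite /two_arms xA' wx; apply/existsP; exists u; apply/existsP; exists u'.
rewrite eu eu' !(crossing_shrink sub) ?nA' //=.
by apply: contra uu'; apply: conn_subset.
Qed.
End Shrink.

(** * Geometry of the discrete torus *)

Section CyclicNorm.
Variable m : nat.
Implicit Types (a b : 'I_m.+1) (k : nat).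

(** Distance to 0 in the cyclic group of order [m.+1]. *)
Definition nrm a : nat := minn a (m.+1 - a).

Lemma nrm0 : nrm 0 = 0%N.
Proof. by rewrite /nrm min0n. Qed.

Lemma nrmN a : nrm (- a) = nrm a.
Proof.
rewrite /nrm /=; have := ltn_ord a; case: (posnP a) => [->|a0] am.
  by rewrite subn0 modnn min0n.
by rewrite modn_small; lia.
Qed.

Lemma nrmD a b : (nrm (a + b)%R <= nrm a + nrm b)%N.
Proof.
rewrite /nrm /=; have := ltn_ord a; have := ltn_ord b => bm am.
have [ab|ab] := ltnP (a + b) m.+1; first by rewrite modn_small //; lia.
have -> : ((a + b) %% m.+1 = a + b - m.+1)%N.
  by rewrite -{1}(subnK ab) modnDr modn_small //; lia.
lia.
Qed.

Lemma nrmB a b : nrm (a - b)%R = nrm (b - a)%R.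
Proof. by rewrite -nrmN opprB. Qed.

Definition signed (b : bool) a : 'I_m.+1 := if b then - a else a.

Lemma nrm_signed (b : bool) a : nrm (signed b a) = nrm a.
Proof. by case: b; rewrite /signed ?nrmN. Qed.

Lemma nrm_inZp k : (nrm (inZp k) <= k)%N.
Proof. by rewrite /nrm /= geq_min leq_mod. Qed.

Lemma inZpD k l : inZp (k + l) = inZp k + inZp l :> 'I_m.+1.
Proof. by apply: val_inj; rewrite /= modnDm. Qed.

Lemma nrmP a : a = inZp (nrm a) \/ a = - inZp (nrm a).
Proof.
rewrite /nrm; have := ltn_ord a => am.
have [le|lt] := leqP a (m.+1 - a); first by left; rewrite valZpK.
right; apply: val_inj; rewrite /= [((m.+1 - a) %% m.+1)%N]modn_small ?modn_small; lia.
Qed.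

(** Balls much smaller than the cycle are intervals. *)
Lemma nrm_between n k l a (b : bool) : (6 * n <= m)%N -> (k <= 2 * n)%N -> (l <= k)%N ->
  (nrm a <= n)%N -> (nrm (a + signed b (inZp k))%R <= n)%N ->
  (nrm (a + signed b (inZp l))%R <= n)%N.
Proof.
move=> nm kn lk; suff H c : (nrm c <= n)%N -> (nrm (c + inZp k)%R <= n)%N ->
    (nrm (c + inZp l)%R <= n)%N.
  case: b; rewrite /signed; last exact: H.
  rewrite -(nrmN a) -(nrmN (a - _)) -(nrmN (a - inZp l)) !opprD !opprK; exact: H.
have add (j : nat) : (j <= m)%N -> ((c + inZp j : 'I_m.+1)%R : nat) =
    if (c + j < m.+1)%N then (c + j)%N else (c + j - m.+1)%N.
  move=> jm; rewrite /= (modn_small (m := j)) //; case: ltnP => cj; first by rewrite modn_small.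
  rewrite -{1}(subnK cj) modnDr modn_small //.
  by have := ltn_ord c; clear -jm cj; lia.
rewrite /nrm !add; [|clear -nm kn lk; lia|clear -nm kn; lia].
have := ltn_ord c; clear -nm kn lk.
by case: ifP; case: ifP; lia.
Qed.
End CyclicNorm.

Section Sums.
Context (R : realType).

Lemma sum_inj_le (I : finType) (P : pred I) (h : I -> nat) (n : nat) (g : nat -> R) :
  (forall j, 0 <= g j) -> {in P &, injective h} -> (forall i, P i -> (h i < n)%N) ->
  \sum_(i | P i) g (h i) <= \sum_(j < n) g j.
Proof.
move=> g0 hI hn.
have -> : \sum_(i | P i) g (h i) = \sum_(j < n) \sum_(i | P i && (h i == j)) g j.
  rewrite (exchange_big_dep P) /=; last by move=> j i _ /andP[].
  apply: eq_bigr => i Pi; rewrite (bigD1 (Ordinal (hn i Pi))) /=; last by rewrite Pi eqxx.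
  rewrite big1 ?addr0 // => j /andP[/andP[_ /eqP hij] /eqP]; case.
  exact: val_inj.
apply: ler_sum => j _; case: (pickP (fun i => P i && (h i == j))) => [i /andP[Pi /eqP hi]|none].
  rewrite (bigD1 i) /=; last by rewrite Pi hi eqxx.
  rewrite big1 ?addr0 // => i' /andP[/andP[Pi' /eqP hi'] /eqP]; case.
  by apply: hI => //; rewrite hi.
by rewrite big_pred0.
Qed.

(** Each value of [nrm] is attained at most twice. *)
Lemma sum_nrm_le m M (g : nat -> R) : (forall j, 0 <= g j) ->
  \sum_(a : 'I_m.+1 | (nrm a <= M)%N) g (nrm a) <= 2 * \sum_(j < M.+1) g j.
Proof.
move=> g0; rewrite (_ : 2 = 1 + 1) // mulrDl mul1r.
rewrite (bigID (fun a : 'I_m.+1 => (a <= m.+1 - a)%N)) /=; apply: lerD.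
  apply: sum_inj_le => // [a b /andP[_ Ha] /andP[_ Hb]|a /andP[]//].
  rewrite /nrm (minn_idPl Ha) (minn_idPl Hb).
  exact: val_inj.
apply: sum_inj_le => // [a b /andP[_ Ha] /andP[_ Hb]|a /andP[]//].
move: Ha Hb; rewrite /nrm -!ltnNge => Ha Hb.
have := ltn_ord a; have := ltn_ord b => bm am.
by rewrite (minn_idPr (ltnW Ha)) (minn_idPr (ltnW Hb)) => E; apply: val_inj => /=; lia.
Qed.

Lemma sum_inv_sqrt n : \sum_(j < n) (Num.sqrt j.+1%:R)^-1 <= 2 * Num.sqrt n%:R :> R.
Proof.
elim: n => [|n IH]; first by rewrite big_ord0 sqrtr0 mulr0.
rewrite big_ord_recr /=; apply: le_trans (lerD IH (lexx _)) _.
set a : R := Num.sqrt n%:R; set b : R := Num.sqrt n.+1%:R.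
have a0 : 0 <= a by apply: sqrtr_ge0.
have b0 : 0 < b by rewrite sqrtr_gt0 ltr0n.
have aa : a * a = n%:R by rewrite -expr2 sqr_sqrtr.
have bb : b * b = n%:R + 1 by rewrite -expr2 sqr_sqrtr // -natr1.
rewrite -(ler_pM2r b0) mulrDl mulVf ?gt_eqF //.
have : 0 <= (b - a) ^+ 2 by rewrite sqr_ge0.
nra.
Qed.
End Sums.

Section Torus.
Context (d m : nat).
Notation torus := {ffun 'I_d -> 'I_m.+1}.
Implicit Types (u v x y c : torus) (r s : nat) (w : {ffun torus -> bool}).

Definition adj (u v : torus) : bool := (\sum_i nrm (v i - u i)%R == 1)%N.

Definition cube x r : {set torus} := [set v : torus | [forall i, (nrm (v i - x i)%R <= r)%N]].

Definition supnrm v : nat := \max_i nrm (v i).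

Lemma cubeP x r v : reflect (forall i, (nrm (v i - x i)%R <= r)%N) (v \in cube x r).
Proof. by rewrite inE; apply: forallP. Qed.

Lemma adj_sym : symmetric adj.
Proof. by move=> u v; rewrite /adj; under eq_bigr do rewrite nrmB. Qed.

Lemma adj_nrm u v i : adj u v -> (nrm (v i - u i)%R <= 1)%N.
Proof. by move=> /eqP <-; rewrite (bigD1 i) //= leq_addr. Qed.

Lemma adjD c u v : adj (u + c) (v + c) = adj u v.
Proof.
rewrite /adj; under eq_bigr => i _.
  rewrite !ffunE opprD addrACA subrr addr0.
  over.
by [].
Qed.

Lemma cube_center x r : x \in cube x r.
Proof. by apply/cubeP => i; rewrite subrr nrm0. Qed.

Lemma cube_trans x y v r s : x \in cube y s -> v \in cube x r -> v \in cube y (r + s).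
Proof.
move=> /cubeP xy /cubeP vx; apply/cubeP => i; rewrite -(subrK (x i) (v i)) -addrA.
by apply: leq_trans (nrmD _ _) _; apply: leq_add.
Qed.

Lemma cube_sym x y r : (x \in cube y r) = (y \in cube x r).
Proof. by apply/cubeP/cubeP => H i; rewrite nrmB. Qed.

Lemma cubeS x r s v : (r <= s)%N -> v \in cube x r -> v \in cube x s.
Proof. by move=> rs /cubeP vx; apply/cubeP => i; apply: leq_trans (vx i) rs. Qed.

Lemma adj_cube u v : adj u v -> v \in cube u 1.
Proof. by move=> uv; apply/cubeP => i; apply: adj_nrm. Qed.

Lemma cubeD c x r v : (v + c \in cube (x + c) r) = (v \in cube x r).
Proof.
by apply/cubeP/cubeP => H i; move: (H i); rewrite !ffunE opprD addrACA subrr addr0.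
Qed.

Lemma cube0 r v : (v \in cube 0 r) = (supnrm v <= r)%N.
Proof.
apply/cubeP/bigmax_leqP => [H i _|H i]; first by move: (H i); rewrite ffunE subr0.
by rewrite ffunE subr0 H.
Qed.

Lemma cubeN r v : (- v \in cube 0 r) = (v \in cube 0 r).
Proof.
by apply/cubeP/cubeP => H i; move: (H i); rewrite !ffunE !subr0 nrmN.
Qed.

Lemma supnrm_adj u v : adj u v -> (supnrm v <= (supnrm u).+1)%N.
Proof.
move=> uv; rewrite -cube0 -(add1n (supnrm u)); apply: cube_trans (adj_cube uv).
by rewrite cube0.
Qed.

(** A cluster that reaches the boundary of a cube meets every sphere in
    between, which bounds its size from below. *)
Lemma crossing_card w M x :
  crossing adj w (cube 0 M) (inner_boundary adj (cube 0 M)) x ->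
  ((M - supnrm x).+1 <= #|cluster adj w (cube 0%R M) x|)%N.
Proof.
case/existsP => b /andP[]; rewrite inE => /andP[bM /existsP[b' /andP[b'M bb']]] xb.
have xM : (supnrm x <= M)%N by rewrite -cube0; case/andP: (conn_openl xb).
have nb : supnrm b = M.
  apply/eqP; rewrite eqn_leq -cube0 bM /= -ltnS.
  by apply: leq_trans (supnrm_adj bb'); rewrite ltnNge -cube0.
have level (k : 'I_(M - supnrm x).+1) : exists v, conn adj w (cube 0 M) x v /\
    supnrm v = (supnrm x + k)%N.
  have := ltn_ord k; rewrite ltnS leq_eqVlt => /predU1P[kE|kM].
    by exists b; rewrite kE nb subnKC.
  pose K := [set v | (supnrm v <= supnrm x + k)%N].
  have xK : x \in K by rewrite inE leq_addr.
  have bK : b \notin K by rewrite inE nb -ltnNge; lia.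
  have [u [v [uK vK uv xu _]]] := conn_exit xK bK xb.
  exists u; split; first by apply: conn_subset xu; apply: subsetIl.
  move: uK vK; rewrite !inE -ltnNge => uk vk; apply/eqP; rewrite eqn_leq uk /= -ltnS.
  exact: leq_trans vk (supnrm_adj uv).
have [f fP] := fin_all_exists level.
rewrite -[leqLHS]card_ord -(card_codom (f := f)); last first.
  move=> i j fij; apply: val_inj; apply: (@addnI (supnrm x)).
  by rewrite -(fP i).2 -(fP j).2 fij.
apply/subset_leq_card/fintype.subsetP => v /codomP[k ->]; rewrite clusterP.
by case: (fP k).
Qed.

Section Size.
Context (R : realType).

Lemma sum_cube_prod r (G : 'I_d -> 'I_m.+1 -> R) :
  \sum_(v in cube 0 r) \prod_i G i (v i) = \prod_i \sum_(a | (nrm a <= r)%N) G i a.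
Proof.
rewrite bigA_distr_big /=; apply: eq_bigl => v.
apply/cubeP/ffun_onP => H i; move: (H i); rewrite ffunE subr0 //.
Qed.

Lemma card_cube0 r : #|cube 0 r|%:R = (\sum_(a : 'I_m.+1 | (nrm a <= r)%N) 1) ^+ d :> R.
Proof.
rewrite -sumr_const -[X in _ ^+ X]card_ord -prodr_const -(sum_cube_prod r (fun _ _ => 1)).
by apply: eq_bigr => v _; rewrite big1.
Qed.

Lemma card_cube x r : #|cube x r|%:R <= (2 * r.+1%:R) ^+ d :> R.
Proof.
have -> : #|cube x r| = #|cube 0 r|.
  rewrite -(card_imset (cube 0 r) (addIr x)); apply: eq_card => v.
  apply/idP/imsetP => [vx|[u u0 ->]].
    by exists (v - x); rewrite ?subrK // -(cubeD x) subrK add0r.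
  by rewrite -[X in cube X](add0r x) cubeD.
rewrite card_cube0; apply: lerXn2r; rewrite ?nnegrE ?sumr_ge0 // ?mulr_ge0 //.
apply: le_trans (sum_nrm_le m r (g := fun=> 1) _) _ => //.
by rewrite sumr_const card_ord.
Qed.

Lemma card_cube_ge M : (M <= m)%N -> M.+1%:R ^+ d <= #|cube 0 M|%:R :> R.
Proof.
move=> Mm; rewrite card_cube0; apply: lerXn2r; rewrite ?nnegrE ?sumr_ge0 //.
rewrite sumr_const ler_nat; have Mm1 : (M.+1 <= m.+1)%N by [].
rewrite -[leqLHS](card_ord M.+1) -(card_codom (f := widen_ord Mm1)); last first.
  by move=> i j /(congr1 val) /= /val_inj.
apply/subset_leq_card/fintype.subsetP => a /codomP[j ->]; suff: (nrm (widen_ord Mm1 j) <= M)%N by [].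
by rewrite /nrm /= geq_min -ltnS ltn_ord.
Qed.

Lemma degree_adj u : (#|[set v | adj u v]| <= 4 ^ d)%N.
Proof.
rewrite -(ler_nat R) natrX; apply: (@le_trans _ _ #|cube u 1|%:R).
  rewrite ler_nat; apply/subset_leq_card/fintype.subsetP => v; rewrite inE.
  exact: adj_cube.
apply: le_trans (card_cube u 1) _; by rewrite -natrM.
Qed.

(** The sup norm of [x] is the norm of one of its coordinates, so the summand is at
    most a sum over coordinates, and each term then factorizes over the cube. *)
Lemma sum_layers M : (0 < d)%N ->
  \sum_(x in cube 0 M) (Num.sqrt (M - supnrm x).+1%:R)^-1 <=
  d%:R * (2 * M.+1%:R) ^+ d.-1 * (4 * Num.sqrt M.+1%:R) :> R.
Proof.
move=> d0; pose g j : R := (Num.sqrt (M - j).+1%:R)^-1.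
have g0 j : 0 <= g j by rewrite invr_ge0 sqrtr_ge0.
apply: (@le_trans _ _ (\sum_(x in cube 0 M) \sum_i g (nrm (x i)))).
  apply: ler_sum => x _.
  have dI : (0 < #|'I_d|)%N by rewrite card_ord.
  have [i] := bigop.eq_bigmax (fun i => nrm (x i)) dI; rewrite -/(supnrm x) => xi.
  by rewrite (bigD1 i) //= xi lerDl sumr_ge0.
rewrite exchange_big /= -mulrA [leRHS]mulr_natl -[X in _ *+ X](card_ord d).
rewrite -sumr_const; apply: ler_sum => i _.
have -> : \sum_(x in cube 0 M) g (nrm (x i)) =
   \sum_(x in cube 0 M) \prod_k (fun k a => if k == i then g (nrm a) else 1) k (x k).
  by apply: eq_bigr => x _; rewrite -big_mkcond big_pred1_eq.
rewrite (sum_cube_prod M (fun k a => if k == i then g (nrm a) else 1)) (bigD1 i) //= mulrC; apply: ler_pM.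
- by apply: prodr_ge0 => k _; apply: sumr_ge0 => a _; case: ifP.
- by apply: sumr_ge0 => a _; rewrite eqxx.
- have -> : d.-1 = #|predC1 i| by rewrite cardC1 card_ord.
  rewrite -prodr_const; apply: ler_prod => k /negbTE ki.
  rewrite ki sumr_ge0 //=; apply: le_trans (sum_nrm_le m M (g := fun=> 1) _) _ => //.
  by rewrite sumr_const card_ord.
- rewrite eqxx; apply: le_trans (sum_nrm_le m M g0) _.
  have -> : 4 = 2 * 2 :> R by rewrite -natrM.
  rewrite -mulrA ler_pM2l //; apply: le_trans (sum_inv_sqrt R M.+1).
  rewrite (reindex_inj rev_ord_inj) /= le_eqVlt; apply/orP; left; apply/eqP.
  by apply: eq_bigr => j _; rewrite /g subSS subKn // -ltnS ltn_ord.
Qed.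

Variable p : R.
Hypothesis p01 : 0 < p <= 1.

Definition two_arms_const : R :=
  (excess_const (4 ^ d) p + p) / p * (d%:R * 4 ^+ d.-1 * 8).

Lemma excess_const_ge0 D : 0 <= excess_const D p.
Proof.
have /andP[p0 p1] := p01; have q0 : 0 <= 1 - p by rewrite subr_ge0.
apply: mulr_ge0; first by apply: mulr_ge0 => //; apply: ltW.
apply: addr_ge0; last by rewrite divr_ge0 // ltW.
apply: mulr_ge0; first exact: ltW.
by apply: addr_ge0; rewrite divr_ge0 ?ler0n // exprn_ge0 // ltW.
Qed.

Lemma two_arms_const_ge0 : 0 <= two_arms_const.
Proof.
have /andP[/ltW p0 _] := p01; apply: mulr_ge0.
  by rewrite divr_ge0 ?addr_ge0 ?excess_const_ge0.
by apply: mulr_ge0 => //; apply: mulr_ge0; rewrite ?ler0n // exprn_ge0.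
Qed.

Lemma prob_two_arms_p1 A B z : p = 1 -> prob p (fun w => two_arms adj w A B z) = 0.
Proof.
move=> p1; apply/eqP; rewrite eq_le prob_ge0 ?p1 ?ler01 ?lexx // andbT.
apply: (@le_trans _ _ (prob 1 (fun w => ~~ w z))).
  by apply: le_prob; rewrite ?ler01 ?lexx // => w /and3P[].
by rewrite /prob (mean_site 1 z (fun b => (~~ b)%:R)) /= mulr0 mulr1 subrr addr0.
Qed.

Lemma sum_two_arms_cube M : (0 < d)%N ->
  \sum_z prob p (fun w => two_arms adj w (cube 0 M) (inner_boundary adj (cube 0 M)) z) <=
  (excess_const (4 ^ d) p + p) / p *
    (d%:R * (2 * M.+1%:R) ^+ d.-1 * (4 * Num.sqrt M.+1%:R)).
Proof.
move=> d0; have /andP[p0 p1] := p01.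
have E0 := excess_const_ge0 (4 ^ d).
have C0 : 0 <= (excess_const (4 ^ d) p + p) / p by rewrite divr_ge0 ?addr_ge0 // ltW.
have [p1'|pn1] := eqVneq p 1.
  rewrite big1 => [|z _]; last exact: prob_two_arms_p1.
  by apply: mulr_ge0 => //; rewrite !mulr_ge0 ?exprn_ge0 ?mulr_ge0 ?sqrtr_ge0 ?ler0n.
have pp : 0 < p < 1 by rewrite p0 lt_neqAle pn1.
have BA : inner_boundary adj (cube 0 M) \subset cube 0 M.
  by apply/fintype.subsetP => v; rewrite inE => /andP[].
have H := two_arms_sum adj_sym degree_adj pp BA (l := fun x => (M - supnrm x).+1)
  (fun=> erefl) (fun w x => @crossing_card w M x).
apply: (@le_trans _ _ ((excess_const (4 ^ d) p + p) / p *
    (\sum_(x in cube 0 M) (Num.sqrt (M - supnrm x).+1%:R)^-1))); last first.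
  by apply: ler_wpM2l => //; apply: sum_layers.
rewrite mulrAC ler_pdivlMr // mulrC; apply: le_trans H _; rewrite mulrDl lerD2l.
rewrite ler_pM2l // -sumr_const big_mkcond [leRHS]big_mkcond /=; apply: ler_sum => x _.
case: ifPn => [xB|_]; last by case: ifP => // _; rewrite invr_ge0 sqrtr_ge0.
rewrite (fintype.subsetP BA) //.
(* boundary sites form the outermost layer, whose weight is one *)
have -> : (M - supnrm x = 0)%N.
  apply/eqP; rewrite subn_eq0.
  move: xB; rewrite inE => /andP[_ /existsP[y /andP[yM xy]]].
  by rewrite -ltnS; apply: leq_trans (supnrm_adj xy); rewrite ltnNge -cube0.
by rewrite sqrtr1 invr1.
Qed.

(** By translation and inclusion, the two-arm probability at a site deep in a
    cube is at most the average over the sites of a smaller cube. *)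
Lemma prob_two_arms_le M N s u : (0 < d)%N -> (M <= m)%N -> (M.+1 + M + s <= N)%N ->
  u \in cube 0 s ->
  prob p (fun w => two_arms adj w (cube 0 N) (inner_boundary adj (cube 0 N)) u) <=
  two_arms_const / Num.sqrt M.+1%:R.
Proof.
move=> d0 Mm MN us; have /andP[p0 p1] := p01; have p01' : 0 <= p <= 1 by rewrite ltW.
set Pu := prob _ _.
have Pu0 : 0 <= Pu by apply: prob_ge0.
have M0 : 0 < M.+1%:R :> R by rewrite ltr0n.
have H1 : M.+1%:R ^+ d * Pu <= \sum_z prob p (fun w =>
    two_arms adj w (cube 0 M.+1) (inner_boundary adj (cube 0 M.+1)) z).
  apply: (@le_trans _ _ (\sum_(z in cube 0 M) Pu)).
    by rewrite sumr_const -[leRHS]mulr_natl ler_wpM2r // card_cube_ge.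
  rewrite [leLHS]big_mkcond /=.
  apply: ler_sum => z _.
  case: ifPn => zM; last by apply: (prob_ge0 p01').
  (* the large cube, translated so that [u] comes to [z], contains the small one *)
  pose A' := cube (z - u) N.
  have fA v : (v + (u - z) \in cube 0 N) = (v \in A').
    by rewrite -(cubeD (u - z) (z - u)) -(opprB z u) addrN.
  have zu : z + (u - z) = u by rewrite addrC subrK.
  have E : Pu = prob p (fun w => two_arms adj w A' (inner_boundary adj A') z).
    rewrite -(prob_two_arms_automorphism p (addIr (u - z)) (adjD (u - z)) fA z) /=.
    by rewrite zu.
  rewrite E; apply: (le_prob p01') => w; apply: two_arms_shrink.
  - apply/fintype.subsetP => v vM; apply: (cubeS MN); rewrite -addnA.
    apply: cube_trans vM; rewrite cube_sym; apply: (@cube_trans (- u)).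
      by rewrite cubeN.
    by rewrite -[X in cube X](add0r (- u)) cubeD.
  - exact: cubeS zM.
  - move=> t tz; rewrite -(add1n M); apply: cube_trans zM _; apply: adj_cube; by rewrite adj_sym.
have H2 := le_trans H1 (sum_two_arms_cube M.+1 d0).
rewrite ler_pdivlMr ?sqrtr_gt0 // -(ler_pM2l (x := M.+1%:R ^+ d)) ?exprn_gt0 //.
rewrite mulrA; apply: le_trans (ler_wpM2r (sqrtr_ge0 _) H2) _.
set k := (excess_const _ _ + p) / p.
have k0 : 0 <= k by rewrite divr_ge0 ?addr_ge0 ?excess_const_ge0 // ltW.
have MM : M.+2%:R <= 2 * M.+1%:R :> R by rewrite -natrM ler_nat mul2n -addnn addSn ltnS leq_addl.
have sM : Num.sqrt M.+2%:R <= 2 * Num.sqrt M.+1%:R :> R.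
  have -> : 2 = Num.sqrt (2 ^+ 2) :> R by rewrite sqrtr_sqr ger0_norm.
  rewrite -sqrtrM ?exprn_ge0 // ler_wsqrtr // (le_trans MM) // ler_wpM2r //; lra.
have ss : Num.sqrt M.+1%:R * Num.sqrt M.+1%:R = M.+1%:R :> R by rewrite -expr2 sqr_sqrtr // ltW.
apply: (@le_trans _ _ (k * (d%:R * (4 * M.+1%:R) ^+ d.-1 * (4 * (2 * Num.sqrt M.+1%:R))) *
   Num.sqrt M.+1%:R)).
  apply: ler_wpM2r; first exact: sqrtr_ge0.
  apply: ler_wpM2l => //; apply: ler_pM; rewrite ?mulr_ge0 ?exprn_ge0 ?mulr_ge0 ?sqrtr_ge0 //.
    apply: ler_wpM2l => //; apply: lerXn2r; rewrite ?nnegrE ?mulr_ge0 //.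
    by move: MM; lra.
  by apply: ler_wpM2l.
have -> : M.+1%:R ^+ d = M.+1%:R ^+ d.-1 * M.+1%:R :> R by rewrite -exprSr prednK.
rewrite /two_arms_const -/k exprMn le_eqVlt; apply/orP; left; apply/eqP.
set X := _ ^+ d.-1; set Y := _ ^+ d.-1.
move: ss; set t := Num.sqrt _ => ss; rewrite -ss; ring.
Qed.
End Size.
End Torus.

(** * Chains of hops in a large cube *)

Section Hops.
Context (R : realType) (d m : nat).
Notation torus := {ffun 'I_d -> 'I_m.+1}.
Variables (p theta0 : R) (N : nat).
Hypothesis d0 : (0 < d)%N.
Hypothesis p01 : 0 < p <= 1.
Hypothesis theta0_gt0 : 0 < theta0.
Implicit Types (u v x y : torus) (r s : nat) (w : {ffun torus -> bool}) (i : 'I_d).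

Local Notation A := (cube (0 : torus) N).
Local Notation border X := (inner_boundary (@adj d m) X).
Local Notation cross r x w := (crossing (@adj d m) w (cube 0 r) (border (cube 0 r)) x).

Hypothesis one_arm : forall r, (r <= N + N)%N ->
  theta0 <= prob p (fun w => crossing (@adj d m) w (cube 0 r) (border (cube 0 r)) 0).

Let p01' : 0 <= p <= 1. Proof. by case/andP: p01 => /ltW -> ->. Qed.
Let p0 : 0 <= p. Proof. by case/andP: p01'. Qed.
Let p1 : p <= 1. Proof. by case/andP: p01'. Qed.

Lemma one_arm_cube x : x \in A ->
  theta0 <= prob p (fun w => crossing (@adj d m) w A (border A) x).
Proof.
move=> xA; apply: le_trans (one_arm (leqnn _)) _.
rewrite -(prob_crossing_automorphism p (addIr x) (adjD x) (A' := cube x (N + N))); last first.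
  by move=> v; rewrite -[X in cube X]add0r cubeD.
rewrite add0r; apply: (le_prob p01') => w; apply: crossing_shrink => //.
apply/fintype.subsetP => v vA; apply: cube_trans vA; by rewrite cube_sym.
Qed.

Definition hop_prob r : R := theta0 / (2 * r.+1%:R) ^+ d.

Definition reachable r v :=
  v \in cube 0 r /\ hop_prob r <= prob p (fun w => conn (@adj d m) w (cube 0 r) 0 v).

Lemma size_gt0 r : 0 < (2 * r.+1%:R : R) ^+ d.
Proof. by rewrite exprn_gt0 // mulr_gt0. Qed.

(** The arm from the origin ends at one of at most [(2 (r + 1)) ^ d] boundary sites,
    so one of them gets its share of the probability. *)
Lemma exists_reachable r : (r <= N + N)%N -> exists v, reachable r v /\ supnrm v = r.
Proof.
move=> rN; pose Bd := border (cube (0 : torus) r).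
have Bdr v : v \in Bd -> v \in cube 0 r /\ supnrm v = r.
  rewrite inE => /andP[vr /existsP[u /andP[ur vu]]]; split=> //.
  apply/eqP; rewrite eqn_leq -cube0 vr /= -ltnS.
  by apply: leq_trans (supnrm_adj vu); rewrite ltnNge -cube0.
have [/existsP[v /andP[vB hv]]|none] := boolP [exists v in Bd,
    hop_prob r <= prob p (fun w => conn (@adj d m) w (cube 0 r) 0 v)].
  by have [vr nv] := Bdr v vB; exists v.
have: theta0 < theta0; last by rewrite ltxx.
have B0 : (0 < #|Bd|)%N.
  rewrite card_gt0; apply/negP => /eqP B0.
  have := one_arm rN; rewrite -/Bd B0 leNgt => /negP; apply.
  apply: le_lt_trans theta0_gt0; rewrite -[leRHS](@mean0 R torus p); apply: (le_mean p01') => w.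
  by rewrite lern0 eqb0; apply/existsP => -[b]; rewrite inE.
apply: le_lt_trans (one_arm rN) _.
apply: (@le_lt_trans _ _ (\sum_(v in Bd) prob p (fun w => conn (@adj d m) w (cube 0 r) 0 v))).
  exact: prob_exists.
apply: (@lt_le_trans _ _ (\sum_(v in Bd) hop_prob r)).
  have /card_gt0P[v vB] := B0; rewrite (bigD1 v) //= [ltRHS](bigD1 v) //=.
  have lt t : t \in Bd -> prob p (fun w => conn (@adj d m) w (cube 0 r) 0 t) < hop_prob r.
    move=> tB; rewrite ltNge; apply: contra none => H; apply/existsP; exists t.
    by rewrite tB.
  by apply: ltr_leD; [exact: lt|apply: ler_sum => t /andP[/lt/ltW]].
rewrite sumr_const -[leLHS]mulr_natl /hop_prob mulrCA ler_piMr ?(ltW theta0_gt0) //.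
rewrite ler_pdivrMr ?size_gt0 // mul1r; apply: le_trans (card_cube R (0 : torus) r).
by rewrite ler_nat; apply/subset_leq_card/fintype.subsetP => v /Bdr[].
Qed.

(** The lattice symmetries that fix the origin. *)
Definition signed_perm (g : {perm 'I_d}) (b : 'I_d -> bool) v : torus :=
  [ffun i => signed (b i) (v (g i))].

Lemma signed_perm_reachable g b r v : reachable r v -> reachable r (signed_perm g b v).
Proof.
have fA u : (signed_perm g b u \in cube 0 r) = (u \in cube 0 r).
  apply/cubeP/cubeP => H i.
    by move: (H ((g^-1)%g i)); rewrite !ffunE !subr0 nrm_signed permKV.
  by move: (H (g i)); rewrite !ffunE !subr0 nrm_signed.
have fI : injective (signed_perm g b).
  move=> u u' /ffunP H; apply/ffunP => i; move: (H ((g^-1)%g i)).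
  by rewrite !ffunE permKV /signed; case: (b _) => // /oppr_inj.
have fe u u' : adj (signed_perm g b u) (signed_perm g b u') = adj u u'.
  rewrite /adj [in RHS](reindex_inj (@perm_inj _ g)) /=; congr (_ == _).
  apply: eq_bigr => i _; rewrite !ffunE /signed; case: (b i) => //.
  by rewrite -opprD nrmN.
have f0 : signed_perm g b 0 = 0.
  by apply/ffunP => i; rewrite !ffunE /signed; case: (b i); rewrite ?oppr0.
case=> vr hv; split; first by rewrite fA.
by have := prob_conn_automorphism p fI fe fA 0 v; rewrite f0 => ->.
Qed.

Definition linked c x y := c <= prob p (fun w => conn (@adj d m) w A x y).

Lemma linked_le c c' x y : c' <= c -> linked c x y -> linked c' x y.
Proof. exact: le_trans. Qed.

Lemma linked_trans c c' x y z : 0 <= c -> 0 <= c' ->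
  linked c x y -> linked c' y z -> linked (c * c') x z.
Proof.
move=> c0 c'0 xy yz; rewrite /linked; apply: (le_trans (ler_pM c0 c'0 xy yz)).
apply: (le_trans (harris_prob p01' (@conn_increasing _ _ A x y) (@conn_increasing _ _ A y z))).
by apply: (le_prob p01') => w /andP[]; apply: conn_trans.
Qed.

Lemma prob_open v : v \in A -> prob p (fun w => open_in w A v) = p.
Proof.
move=> vA; rewrite -[RHS]addr0 -[X in _ = X + _]mulr1 -(mulr0 (1 - p)).
rewrite -(mean_site p v (fun b => b%:R)); apply: eq_mean => w.
by rewrite /open_in vA andbT.
Qed.

Lemma linked_refl x : x \in A -> linked p x x.
Proof.
by move=> xA; rewrite /linked -{1}(prob_open xA); apply: (le_prob p01') => w; apply: conn_refl.
Qed.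

Lemma linked_adj x y : x \in A -> y \in A -> adj x y -> linked (p ^+ 2) x y.
Proof.
move=> xA yA xy; rewrite /linked expr2 -{1}(prob_open xA) -{2}(prob_open yA).
have inc v : increasing_ev (fun w : {ffun torus -> bool} => open_in w A v).
  by move=> w w' ww' /andP[wv vA]; rewrite /open_in vA (implyP (ww' v)).
apply: le_trans (harris_prob p01' (inc x) (inc y)) _.
by apply: (le_prob p01') => w /andP[ox oy]; apply: conn1.
Qed.

(** Both sites have an arm with probability at least [theta0 ^+ 2]. By
    [separate_conn_le], a connection in the small cube, even of polynomially small
    probability, makes it unlikely that the two arms stay apart. *)
Lemma hop M s r x v : (M <= m)%N -> (M.+1 + M + s <= N)%N ->
  reachable r v -> cube x r \subset cube 0 s ->
  two_arms_const d p / Num.sqrt M.+1%:R * ((2 * r.+1%:R) ^+ d) ^+ 2 <= theta0 ^+ 3 / 2 ->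
  linked (theta0 ^+ 2 / 2) x (x + v).
Proof.
move=> Mm MN [vr hv] xs small.
have sN : (s <= N)%N by apply: leq_trans MN; apply: leq_addl.
have sA : cube x r \subset A.
  by apply/fintype.subsetP => u /(fintype.subsetP xs); apply: cubeS.
have xA : x \in A by apply: (fintype.subsetP sA); apply: cube_center.
have xvA : x + v \in A.
  by apply: (fintype.subsetP sA); rewrite addrC -[X in cube X]add0r cubeD.
pose S := prob p (fun w => separate (@adj d m) w A (border A) x (x + v)).
have S0 : 0 <= S by apply: prob_ge0.
have K0 := size_gt0 r; set K := (_ ^+ d) in K0 small.
have H1 : S * hop_prob r <= K * (two_arms_const d p / Num.sqrt M.+1%:R).
  apply: (@le_trans _ _ (S * prob p (fun w => conn (@adj d m) w (cube x r) x (x + v)))).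
    apply: ler_wpM2l => //; apply: le_trans hv _.
    rewrite -(prob_conn_automorphism p (addIr x) (adjD x) (A' := cube x r)).
      by rewrite add0r addrC.
    by move=> u; rewrite -[X in cube X]add0r cubeD.
  apply: le_trans (separate_conn_le (@adj_sym d m) p01' (border A) x (x + v) sA) _.
  apply: (@le_trans _ _ (\sum_(u in cube x r) two_arms_const d p / Num.sqrt M.+1%:R)).
    by apply: ler_sum => u /(fintype.subsetP xs); apply: prob_two_arms_le.
  rewrite sumr_const -[leLHS]mulr_natl; apply: ler_wpM2r; last exact: card_cube.
  by rewrite divr_ge0 ?sqrtr_ge0 // two_arms_const_ge0.
have H2 : S <= theta0 ^+ 2 / 2.
  rewrite -(ler_pM2r theta0_gt0).
  have -> : theta0 ^+ 2 / 2 * theta0 = theta0 ^+ 3 / 2 by ring.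
  apply: le_trans small; rewrite expr2 mulrA.
  have : S * hop_prob r * K <= K * (two_arms_const d p / Num.sqrt M.+1%:R) * K.
    by rewrite ler_pM2r.
  have -> : S * hop_prob r * K = S * theta0.
    by rewrite /hop_prob -/K -mulrA mulfVK // gt_eqF.
  by rewrite [K * _]mulrC.
have H3 : theta0 ^+ 2 <= S + prob p (fun w => conn (@adj d m) w A x (x + v)).
  rewrite expr2; apply: (@le_trans _ _ (prob p (fun w => cross N x w) *
      prob p (fun w => cross N (x + v) w))).
    by apply: ler_pM; rewrite ?(ltW theta0_gt0) // one_arm_cube.
  apply: (le_trans (harris_prob p01' (@crossing_increasing _ _ _ _ x)
     (@crossing_increasing _ _ _ _ (x + v)))).
  rewrite /S /prob -meanD; apply: (le_mean p01') => w.
  rewrite /separate; case: (cross N x w) => /=; last by rewrite addr_ge0 ?ler0n.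
  case: (cross N (x + v) w) => /=; last by rewrite addr_ge0 ?ler0n.
  by case: (conn _ _ _ _ _) => /=; rewrite ?addr0 ?add0r.
rewrite /linked; move: H2 H3; set P := prob _ _; lra.
Qed.

Definition axis i a : torus := [ffun k => if k == i then a else 0].

Lemma axisD i a a' : axis i (a + a') = axis i a + axis i a'.
Proof. by apply/ffunP => k; rewrite !ffunE; case: eqP; rewrite ?addr0. Qed.

Lemma signedD b k l : signed b (inZp (k + l)) = signed b (inZp k) + signed b (inZp l) :> 'I_m.+1.
Proof. by rewrite inZpD /signed; case: b; rewrite ?opprD. Qed.

Lemma axis_cube x i b k : x + axis i (signed b (inZp k)) \in cube x k.
Proof.
apply/cubeP => j; rewrite !ffunE addrAC subrr add0r.
by case: eqP; rewrite ?nrm0 // nrm_signed nrm_inZp.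
Qed.

Lemma adj_axis x i b : (0 < m)%N -> adj x (x + axis i (signed b (inZp 1))).
Proof.
move=> m0; rewrite /adj (bigD1 i) //= big1 => [|j /negbTE ji].
  rewrite !ffunE eqxx addrAC subrr add0r nrm_signed /nrm /= modn_small //.
  by rewrite addn0 subn1 (minn_idPl _) //.
by rewrite !ffunE ji addr0 subrr nrm0.
Qed.

Lemma axis0 i b : axis i (signed b (inZp 0)) = 0.
Proof.
apply/ffunP => j; rewrite !ffunE; case: eqP => // _.
have -> : inZp 0 = 0 :> 'I_m.+1 by apply: val_inj; rewrite /= mod0n.
by case: b; rewrite /signed ?oppr0.
Qed.

Lemma linked_walk k x i b : (0 < m)%N ->
  (forall l, (l <= k)%N -> x + axis i (signed b (inZp l)) \in A) ->
  linked (p ^+ (2 * k).+1) x (x + axis i (signed b (inZp k))).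
Proof.
move=> m0; elim: k => [|k IH] kA.
  by have := kA 0%N isT; rewrite axis0 addr0 expr1; apply: linked_refl.
rewrite (_ : (2 * k.+1).+1 = ((2 * k).+1 + 2)%N); last by lia.
have IH' := IH (fun l lk => kA l (leqW lk)).
rewrite exprD; apply: linked_trans IH' _; rewrite ?exprn_ge0 //.
have := kA k.+1 (leqnn _); rewrite -(addn1 k) signedD axisD addrA => kA'.
by apply: linked_adj kA' (adj_axis _ _ _ m0); apply: kA.
Qed.

Lemma linked_walk_cube n k x i b : (0 < m)%N -> (n <= N)%N -> (6 * n <= m)%N ->
  (k <= 2 * n)%N -> x \in cube 0 n -> x + axis i (signed b (inZp k)) \in cube 0 n ->
  linked (p ^+ (2 * k).+1) x (x + axis i (signed b (inZp k))).
Proof.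
move=> m0 nN nm kn xn yn; apply: linked_walk => // l lk; apply: (cubeS nN).
move/cubeP: xn => xn; move/cubeP: yn => yn; apply/cubeP => j.
move: (xn j) (yn j); rewrite !ffunE !subr0; case: (j == i); last by rewrite !addr0.
exact: nrm_between.
Qed.

(** A reachable displacement has a coordinate of maximal size [r]; a symmetry brings
    it to direction [i] with the wanted sign. Adding the displacement whose other
    coordinates are opposite gives [2 r] along the axis, and one unit step
    corrects the parity. *)
Lemma linked_axis M n k x i b : (0 < m)%N -> (M <= m)%N -> (M.+1 + M + 3 * n <= N)%N ->
  (k <= 2 * n)%N -> x \in cube 0 n ->
  two_arms_const d p / Num.sqrt M.+1%:R * ((2 * n.+1%:R) ^+ d) ^+ 2 <= theta0 ^+ 3 / 2 ->
  linked ((theta0 ^+ 2 / 2) ^+ 2 * p ^+ 3) x (x + axis i (signed b (inZp k))).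
Proof.
move=> m0 Mm MN kn xn small.
have [r [c [kE cE rn]]] : exists r c, [/\ (k = r + r + c)%N, (c <= 1)%N & (r <= n)%N].
  by exists k./2, (nat_of_bool (odd k)); rewrite addnn addnC odd_double_half; split=> //; lia.
have [v [vr nv]] : exists v, reachable r v /\ v i = signed b (inZp r).
  have [|v [vr nv]] := @exists_reachable r; first by clear -rn MN; lia.
  have dI : (0 < #|'I_d|)%N by rewrite card_ord.
  have [j] := bigop.eq_bigmax (fun i => nrm (v i)) dI; rewrite -/(supnrm v) nv => rj.
  have [t sE] : exists t : bool, signed t (v j) = signed b (inZp r).
    have [vj|vj] := nrmP (v j); rewrite -rj in vj; rewrite vj.
      by exists b.
    by exists (~~ b); rewrite /signed; case: b => /=; rewrite ?opprK.
  exists (signed_perm (tperm i j) (fun=> t) v); split; first exact: signed_perm_reachable.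
  by rewrite ffunE tpermL sE.
pose v' := signed_perm 1%g (fun j => j != i) v.
have vr' : reachable r v' by apply: signed_perm_reachable.
have vv' : v + v' = axis i (signed b (inZp (r + r))).
  apply/ffunP => j; rewrite !ffunE perm1; case: eqP => [->|_] /=.
    by rewrite /signed /= -/(signed b _) nv inZpD -signedD inZpD.
  by rewrite /signed subrr.
have smallr : two_arms_const d p / Num.sqrt M.+1%:R * ((2 * r.+1%:R) ^+ d) ^+ 2 <= theta0 ^+ 3 / 2.
  apply: le_trans small; apply: ler_wpM2l.
    by rewrite divr_ge0 ?sqrtr_ge0 // two_arms_const_ge0.
  by rewrite !lerXn2r ?nnegrE ?exprn_ge0 ?mulr_ge0 // ler_pM2l // ler_nat.
have sub y l : y \in cube 0 l -> (r + l <= 3 * n)%N -> cube y r \subset cube 0 (3 * n).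
  by move=> yl rl; apply/fintype.subsetP => u uy; apply: (cubeS rl); apply: cube_trans uy.
have h0 : 0 <= theta0 ^+ 2 / 2 by rewrite divr_ge0 ?exprn_ge0 ?(ltW theta0_gt0).
have L1 : linked (theta0 ^+ 2 / 2) x (x + v).
  by apply: (hop Mm MN vr) smallr; apply: (sub x n) => //; clear -rn; lia.
have xvn : x + v \in cube 0 (r + n).
  apply: cube_trans xn _; rewrite addrC -[X in cube X]add0r cubeD; by case: vr.
have L2 : linked (theta0 ^+ 2 / 2) (x + v) (x + v + v').
  by apply: (hop Mm MN vr') smallr; apply: (sub _ (r + n)%N) => //; clear -rn; lia.
have L3 : linked (p ^+ 3) (x + v + v') (x + v + v' + axis i (signed b (inZp c))).
  apply: (@linked_le (p ^+ (2 * c).+1)).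
    by apply: ler_wiXn2l => //; rewrite ltnS -[leqRHS](muln1 2) leq_mul2l.
  apply: linked_walk => // l lc.
  have xvv' : x + v + v' \in cube 0 (r + (r + n)).
    by apply: cube_trans xvn _; rewrite addrC -[X in cube X]add0r cubeD; case: vr'.
  apply: cubeS (cube_trans xvv' (axis_cube _ _ _ _)); clear -rn cE MN lc; lia.
rewrite kE signedD axisD addrA -vv' addrA [X in linked (X * _)]expr2.
by apply: (linked_trans _ _ (linked_trans h0 h0 L1 L2) L3); [apply: mulr_ge0|apply: exprn_ge0].
Qed.

(** Changing the coordinates one at a time never leaves the small cube. *)
Lemma linked_coordinates c n x y : 0 <= c <= 1 -> (n <= N)%N ->
  x \in cube 0 n -> y \in cube 0 n ->
  (forall z i b k, z \in cube 0 n -> z + axis i (signed b (inZp k)) \in cube 0 n ->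
     (k <= 2 * n)%N -> linked c z (z + axis i (signed b (inZp k)))) ->
  linked (p * c ^+ d) x y.
Proof.
move=> /andP[c0 c1] nN xn yn moves.
pose z k : torus := [ffun j : 'I_d => if (j < k)%N then y j else x j].
have zn k : z k \in cube 0 n.
  move/cubeP: xn => xn; move/cubeP: yn => yn.
  by apply/cubeP => j; rewrite ffunE; case: ifP.
have step k (kd : (k < d)%N) : linked c (z k) (z k.+1).
  pose i := Ordinal kd; pose a := y i - x i.
  have zE : z k.+1 = z k + axis i a.
    apply/ffunP => j; rewrite !ffunE ltnS leq_eqVlt.
    have -> : (j == k :> nat) = (j == i) by [].
    have [->|ji] /= := eqVneq j i; last by rewrite addr0.
    by rewrite ltnn addrC subrK.
  rewrite zE.
  have an : (nrm a <= 2 * n)%N.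
    move/cubeP: xn => /(_ i); move/cubeP: yn => /(_ i); rewrite !ffunE !subr0 => yi xi.
    by apply: leq_trans (nrmD _ _) _; rewrite nrmN mul2n -addnn leq_add.
  have := zn k.+1; rewrite zE; have [E|E] := nrmP a; rewrite E => zin.
    exact: (moves _ i false).
  exact: (moves _ i true).
have main k : (k <= d)%N -> linked (p * c ^+ k) x (z k).
  elim: k => [|k IH] kd.
    have -> : z 0%N = x by apply/ffunP => j; rewrite ffunE.
    by rewrite mulr1; apply: linked_refl; apply: cubeS xn.
  rewrite exprSr mulrA; apply: linked_trans (IH (ltnW kd)) (step k kd) => //.
  by rewrite mulr_ge0 // exprn_ge0.
have -> : y = z d by apply/ffunP => j; rewrite ffunE ltn_ord.
exact: main.
Qed.
End Hops.

(** * Windows of the lattice *)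

Local Open Scope classical_set_scope.
Local Open Scope ring_scope.

Section CyclicInt.
Variable m : nat.
Implicit Types (a : 'I_m.+1) (z : int) (k : nat).

Definition toZp z : 'I_m.+1 := inZp 1 *~ z.

(** The representative of least absolute value. *)
Definition ofZp a : int := if (a + a <= m)%N then Posz a else Posz a - m.+1%:Z.

Lemma toZpE k : toZp (Posz k) = inZp k.
Proof.
rewrite /toZp -pmulrn; elim: k => [|k IH]; first by apply: val_inj; rewrite /= mod0n.
by rewrite -(addn1 k) inZpD -IH mulrnDr mulr1n.
Qed.

Lemma toZpB z z' : toZp (z - z') = toZp z - toZp z'.
Proof. exact: mulrzBr. Qed.

Lemma toZpN z : toZp (- z) = - toZp z.
Proof. exact: mulrNz. Qed.

Lemma ofZpK a : toZp (ofZp a) = a.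
Proof.
rewrite /ofZp; case: ifP => _; first by rewrite toZpE valZpK.
by rewrite toZpB !toZpE valZpK (_ : inZp m.+1 = 0) ?subr0 //; apply: val_inj; rewrite /= modnn.
Qed.

Lemma absz_ofZp a : `|ofZp a|%N = nrm a.
Proof.
rewrite /ofZp /nrm; have := ltn_ord a => am.
by case: ifP => h; [rewrite absz_nat|]; lia.
Qed.

Lemma toZpK z : (2 * `|z| <= m)%N -> ofZp (toZp z) = z.
Proof.
move=> zm; have [k zk] : exists k, z = Posz k \/ z = - Posz k.
  by exists `|z|%N; case: (intP z) => [|n|n]; [left|left|right].
case: zk => zk; rewrite zk ?toZpN toZpE /ofZp /=; rewrite zk in zm.
  rewrite modn_small; last by lia.
  by rewrite ifT //; lia.
rewrite abszN absz_nat in zm.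
rewrite (modn_small (m := k)); last by lia.
case: (posnP k) => [->|k0]; first by rewrite subn0 modnn.
by rewrite modn_small; [rewrite ifF; lia|lia].
Qed.

Lemma nrm_toZp z : (2 * `|z| <= m)%N -> nrm (toZp z) = `|z|%N.
Proof. by move=> zm; rewrite -absz_ofZp toZpK. Qed.

End CyclicInt.

Section Lattice.
Context (R : realType) (d : nat).
Implicit Types (x y : site d).

Definition dist1 x y : nat := \sum_i `|(y ord0 i - x ord0 i)%R|%N.

Definition zsup x : nat := \max_i `|x ord0 i|%N.

(** For integer vectors the square and the absolute value of a coordinate agree as
    long as they are at most one. *)
Lemma neighborE x y : neighbor R x y = (dist1 x y == 1)%N.
Proof.
rewrite /neighbor /euclidean_dist /dist1.
pose S := (\sum_i `|(y ord0 i - x ord0 i)%R| ^ 2)%N.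
have -> : \sum_(i < d) (x ord0 i - y ord0 i)%:~R ^+ 2 = S%:R :> R.
  rewrite /S natr_sum; apply: eq_bigr => i _.
  by rewrite natrX natr_absz intr_norm real_normK ?num_real // -[in LHS]opprB rmorphN sqrrN.
have -> : (Num.sqrt (S%:R : R) == 1) = (S == 1)%N.
  by rewrite -[X in Num.sqrt _ == X](sqrtr1 R) eqr_sqrt ?ler0n ?ler01 // -(eqr_nat R).
have sq (n : nat) : (n <= n ^ 2)%N by rewrite expnS expn1; case: n => // n; rewrite leq_pmulr.
apply/idP/idP => /eqP H; rewrite eqn_leq.
  have le : (\sum_i `|(y ord0 i - x ord0 i)%R| <= 1)%N.
    by rewrite -[leqRHS]H; apply: leq_sum => i _.
  rewrite le /= lt0n; apply: contra_eqN H => /eqP/eqP.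
  rewrite sum_nat_eq0 => /forallP H0; rewrite /S big1 // => i _.
  by have /eqP -> := H0 i.
have le1 i : (`|(y ord0 i - x ord0 i)%R| <= 1)%N by rewrite -[leqRHS]H (bigD1 i) //= leq_addr.
rewrite -eqn_leq -[X in _ == X]H /S; apply/eqP/eq_bigr => i _.
by move: (le1 i); case: `|_|%N => // -[].
Qed.

Lemma zsup_le x n : (zsup x <= n)%N <-> forall i, (`|x ord0 i| <= n)%N.
Proof. by split => [/bigmax_leqP H i|H]; [apply: H|apply/bigmax_leqP => i _]. Qed.

Lemma boxE (r : R) x : 0 <= r -> box d r x <-> (zsup x <= Num.truncn r)%N.
Proof.
move=> r0; have H i : (- r <= (x ord0 i)%:~R <= r) = (`|x ord0 i| <= Num.truncn r)%N.
  by rewrite -ler_norml truncn_ge_nat // natr_absz intr_norm.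
split=> [b|/zsup_le b i]; last by rewrite H.
by apply/zsup_le => i; rewrite -H; apply: b.
Qed.

Section Proj.
Variable m : nat.
Notation torus := {ffun 'I_d -> 'I_m.+1}.

Definition proj x : torus := [ffun i => toZp m (x ord0 i)].
Definition lft (v : torus) : site d := \row_i ofZp (v i).

Lemma lftK v : proj (lft v) = v.
Proof. by apply/ffunP => i; rewrite ffunE mxE ofZpK. Qed.

Lemma lft_inj : injective lft.
Proof. exact: can_inj lftK. Qed.

Lemma projK x : (2 * zsup x <= m)%N -> lft (proj x) = x.
Proof.
move=> xm; apply/rowP => i; rewrite mxE ffunE toZpK //.
have /zsup_le/(_ i) := leqnn (zsup x); lia.
Qed.

Lemma supnrm_lft v : zsup (lft v) = supnrm v.
Proof. by rewrite /zsup /supnrm; apply: eq_bigr => i _; rewrite mxE absz_ofZp. Qed.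

Lemma supnrm_proj x : (2 * zsup x <= m)%N -> supnrm (proj x) = zsup x.
Proof. by move=> xm; rewrite -supnrm_lft projK. Qed.

Lemma proj0 : proj 0 = 0.
Proof. by apply/ffunP => i; rewrite !ffunE mxE. Qed.

Lemma adj_proj x y : (2 * zsup (y - x) <= m)%N -> adj (proj x) (proj y) = neighbor R x y.
Proof.
move=> xym; rewrite neighborE /adj /dist1; congr (_ == _)%N; apply: eq_bigr => i _.
rewrite !ffunE -toZpB nrm_toZp //; have /zsup_le/(_ i) := leqnn (zsup (y - x)).
by rewrite !mxE => H; apply: leq_trans xym; rewrite leq_mul2l.
Qed.

Lemma zsupB x y n k : (zsup x <= n)%N -> (zsup y <= k)%N -> (zsup (y - x) <= n + k)%N.
Proof.
move=> /zsup_le xn /zsup_le yk; apply/zsup_le => i; rewrite !mxE.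
have abs_sub (a b : int) : (`|(b - a)%R| <= `|a| + `|b|)%N by lia.
by apply: leq_trans (abs_sub _ _) _; apply: leq_add.
Qed.

Lemma neighbor_zsup x y : neighbor R x y -> (zsup (y - x) <= 1)%N.
Proof.
rewrite neighborE => /eqP xy; apply/zsup_le => i; rewrite -[leqRHS]xy /dist1 (bigD1 i) //=.
by rewrite !mxE leq_addr.
Qed.

Lemma zsup_neighbor x y : neighbor R x y -> (zsup y <= (zsup x).+1)%N.
Proof.
move=> /neighbor_zsup /zsup_le xy; have /zsup_le xx := leqnn (zsup x).
apply/zsup_le => i; have := xy i; rewrite !mxE => H.
have abs_le (a b : int) : (`|b| <= `|(b - a)%R| + `|a|)%N by lia.
by apply: leq_trans (abs_le (x ord0 i) _) _; rewrite -(add1n (zsup x)); apply: leq_add.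
Qed.

Definition window (w : config d) : {ffun torus -> bool} := [ffun v => w (lft v)].

(** Boxes whose side is at most half the period do not wrap around, so paths can be
    carried in both directions. *)
Lemma connected_in_window (w : config d) n x y : (4 * n <= m)%N -> (zsup x <= n)%N ->
  connected_in R w [set z | (zsup z <= n)%N] x y ->
  conn (@adj d m) (window w) (cube 0 n) (proj x) (proj y).
Proof.
move=> nm _ [s [ps sy os]]; apply/connPath; exists (map proj s).
have small z : z \in x :: s -> (zsup z <= n)%N by move=> /os[].
split.
- rewrite path_map; elim: s x ps small {os sy} => //= z s IH x /andP[xz zs] small.
  have xn : (zsup x <= n)%N by apply: small; rewrite inE eqxx.
  have zn : (zsup z <= n)%N by apply: small; rewrite !inE eqxx orbT.
  rewrite adj_proj ?xz /=; last by have := zsupB xn zn; lia.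
  by apply: IH => // t ts; apply: small; rewrite inE ts orbT.
- by rewrite last_map sy.
- rewrite -map_cons => v /mapP[z zs ->]; have [wz zn] := os z zs.
  rewrite /= in zn; have zm : (2 * zsup z <= m)%N by lia.
  by rewrite /open_in ffunE projK // wz cube0 supnrm_proj.
Qed.

Lemma window_connected_in (w : config d) n u v : (4 * n <= m)%N ->
  conn (@adj d m) (window w) (cube 0 n) u v ->
  connected_in R w [set z | (zsup z <= n)%N] (lft u) (lft v).
Proof.
move=> nm /connPath[s [ps sv os]]; exists (map lft s).
have small z : z \in u :: s -> (supnrm z <= n)%N by move=> /os/andP[_]; rewrite cube0.
split.
- rewrite path_map; elim: s u ps small {os sv} => //= z s IH x /andP[xz zs] small.
  have xn : (supnrm x <= n)%N by apply: small; rewrite inE eqxx.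
  have zn : (supnrm z <= n)%N by apply: small; rewrite !inE eqxx orbT.
  rewrite -!supnrm_lft in xn zn.
  rewrite -adj_proj ?lftK ?xz /=; last by have := zsupB xn zn; lia.
  by apply: IH => // t ts; apply: small; rewrite inE ts orbT.
- by rewrite last_map sv.
- rewrite -map_cons => z /mapP[t ts ->]; have /andP[wt tn] := os t ts.
  by rewrite ffunE in wt; split=> //=; rewrite supnrm_lft -cube0.
Qed.

Lemma connected_in_exit (w : config d) n x y : (zsup x <= n)%N -> (n < zsup y)%N ->
  connected_in R w setT x y -> exists z z',
    [/\ connected_in R w [set z | (zsup z <= n)%N] x z, neighbor R z z' & (n < zsup z')%N].
Proof.
move=> xn yn [s [ps sy os]]; elim: s x xn ps sy os => [|z s IH] x xn /=.
  by move=> _ xy; move: yn; rewrite -xy ltnNge xn.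
case/andP=> xz zs sy os.
have wx : w x by case: (os x); rewrite ?inE ?eqxx.
have [zn|zn] := leqP (zsup z) n; last first.
  exists x, z; split=> //; exists [::]; split=> // t; rewrite inE => /eqP -> //.
have [|t [t' [[s' [ps' st os']] tt' t'n]]] := IH z zn zs sy.
  by move=> t ts; apply: os; rewrite inE ts orbT.
exists t, t'; split=> //; exists (z :: s'); split=> //=; first by rewrite xz.
by move=> u; rewrite inE => /predU1P[->//|]; apply: os'.
Qed.

Lemma connected_in_crossing (w : config d) n y : (4 * n.+1 <= m)%N -> (n < zsup y)%N ->
  connected_in R w setT 0 y ->
  crossing (@adj d m) (window w) (cube 0 n) (inner_boundary (@adj d m) (cube 0 n)) 0.
Proof.
move=> nm yn c; have z0 : (zsup (0 : site d) <= n)%N.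
  by apply/zsup_le => i; rewrite mxE.
have [z [z' [cz zz' z'n]]] := connected_in_exit z0 yn c.
have zn : (zsup z <= n)%N.
  by case: cz => s [_ <- os]; case: (os (last 0 s)); rewrite // mem_last.
have z'n1 : (zsup z' <= n.+1)%N by apply: leq_trans (zsup_neighbor zz') _.
apply/existsP; exists (proj z); apply/andP; split; last first.
  have nm' : (4 * n <= m)%N by lia.
  by have := connected_in_window nm' z0 cz; rewrite proj0.
rewrite inE cube0 supnrm_proj; last by lia.
rewrite zn; apply/existsP; exists (proj z'); rewrite cube0 supnrm_proj; last by lia.
rewrite -ltnNge z'n adj_proj //; have := neighbor_zsup zz'; lia.
Qed.

Lemma crossing_connected_in (w : config d) n : (4 * n.+1 <= m)%N ->
  crossing (@adj d m) (window w) (cube 0 n) (inner_boundary (@adj d m) (cube 0 n)) 0 ->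
  exists y, connected_in R w setT 0 y /\ zsup y = n.
Proof.
move=> nm /existsP[b /andP[]]; rewrite inE => /andP[bn /existsP[b' /andP[b'n bb']]] c.
exists (lft b); split; last first.
  rewrite supnrm_lft; apply/eqP; rewrite eqn_leq -cube0 bn /= -ltnS.
  by apply: leq_trans (supnrm_adj bb'); rewrite ltnNge -cube0.
have nm' : (4 * n <= m)%N by lia.
have [s [ps sy os]] := window_connected_in nm' c.
have l0 : lft 0 = 0 by apply/rowP => i; rewrite !mxE ffunE /ofZp.
by rewrite l0 in ps sy os; exists s; split=> // z /os[].
Qed.

Lemma finite_zsup n : (2 * n <= m)%N -> finite_set [set x : site d | (zsup x <= n)%N].
Proof.
move=> nm; apply: (@sub_finite_set _ _ (lft @` [set: torus])).
  by move=> x /= xn; exists (proj x) => //; rewrite projK //; lia.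
apply: finite_image; exact: finite_finset.
Qed.
End Proj.

(** This form exhibits the event as a countable intersection of events that depend
    on finitely many sites, hence as a measurable one. *)
Lemma infinite_clusterP (w : config d) :
  infinite_set (open_cluster R w 0) <->
  forall n, crossing (@adj d (4 * n.+1)) (window _ w) (cube 0 n)
    (inner_boundary (@adj d (4 * n.+1)) (cube 0 n)) 0.
Proof.
split=> [inf n|H].
  have [y yn c] : exists2 y, (n < zsup y)%N & connected_in R w setT 0 y.
    apply: contrapT => none; apply: inf.
    apply: (sub_finite_set _ (@finite_zsup (4 * n.+1) n _)); last by lia.
    by move=> y cy /=; rewrite leqNgt; apply/negP => yn; apply: none; exists y.
  exact: connected_in_crossing yn c.
move=> /finite_seqP[s sE].
pose N := \max_(x <- s) zsup x.
have [y [cy yN]] := crossing_connected_in (leqnn _) (H N.+1).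
have : y \in s by have : [set` s] y by rewrite -sE.
move=> ys; have : (zsup y <= N)%N by rewrite /N (big_rem y) //= leq_maxl.
by rewrite yN ltnn.
Qed.
End Lattice.

(** * Law of a window *)

Section Law.
Context (R : realType) (d : nat) (disp : measure_display) (T : measurableType disp).
Context (P : probability T R) (X : site d -> {RV P >-> bool}) (p : R).
Hypothesis perc : site_percolation p X.

Local Notation cfg m t := (window m (random_config X t)).

Lemma window_cylinder m (w : {ffun {ffun 'I_d -> 'I_m.+1} -> bool}) :
  [set t | cfg m t = w] =
  \bigcap_(x in [set` map (@lft d m) (enum {: {ffun 'I_d -> 'I_m.+1}})])
    (X x @^-1` [set w (proj m x)]).
Proof.
apply/seteqP; split=> t /=.
  by move=> <- x /= /mapP[v _ ->]; rewrite /= ffunE lftK.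
move=> H; apply/ffunP => v; rewrite ffunE /random_config.
have := H (lft v); rewrite /= lftK; apply; apply: map_f; exact: mem_enum.
Qed.

Lemma measurable_window_cylinder m (w : {ffun {ffun 'I_d -> 'I_m.+1} -> bool}) :
  measurable [set t | cfg m t = w].
Proof.
rewrite window_cylinder; apply: fin_bigcap_measurable; first exact: finite_seq.
by move=> x _; apply: measurable_funPTI.
Qed.

Lemma site_law x b : P (X x @^-1` [set b]) = (bern p b)%:E.
Proof.
have [law _] := perc; case: b; first by rewrite -(law x).
have -> : X x @^-1` [set false] = ~` (X x @^-1` [set true]).
  by apply/seteqP; split=> t /=; case: (X x t) => // /(_ erefl).
rewrite probability_setC; last exact: measurable_funPTI.
by rewrite (_ : P _ = p%:E) // -(law x).
Qed.

Lemma window_cylinder_law m (w : {ffun {ffun 'I_d -> 'I_m.+1} -> bool}) :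
  P [set t | cfg m t = w] = (weight p w)%:E.
Proof.
have [_ indep] := perc; rewrite window_cylinder.
rewrite (indep _ (fun x => [set w (proj m x)])); last first.
  by rewrite map_inj_uniq ?enum_uniq //; exact: lft_inj.
rewrite big_map (eq_bigr (fun v => (bern p (w v))%:E)); last by move=> v _; rewrite site_law lftK.
by rewrite prodEFin /weight big_enum.
Qed.

Section Event.
Variables (m : nat) (Q : pred {ffun {ffun 'I_d -> 'I_m.+1} -> bool}).

Let ws := [seq w <- enum {: {ffun {ffun 'I_d -> 'I_m.+1} -> bool}} | Q w].

Let eventE : [set t | Q (cfg m t)] = \bigcup_(w in [set` ws]) [set t | cfg m t = w].
Proof.
apply/seteqP; split=> t /=.
  by move=> Qt; exists (cfg m t) => //=; rewrite mem_filter Qt mem_enum.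
by case=> w /=; rewrite mem_filter => /andP[Qw _] ->.
Qed.

Lemma measurable_window : measurable [set t | Q (cfg m t)].
Proof.
rewrite eventE; apply: fin_bigcup_measurable; first exact: finite_seq.
by move=> w _; exact: measurable_window_cylinder.
Qed.

Lemma window_law : P [set t | Q (cfg m t)] = (prob p Q)%:E.
Proof.
rewrite eventE measure_fin_bigcup; first last.
- by move=> w _; exact: measurable_window_cylinder.
- by move=> w w' _ _ [t [/= <- <-]].
- exact: finite_seq.
rewrite -fsbig_seq; last by rewrite filter_uniq // enum_uniq.
rewrite (eq_bigr (fun w => (weight p w)%:E)) => [|w _]; last exact: window_cylinder_law.
rewrite sumEFin /ws big_filter big_enum_cond /= /prob /mean; congr EFin.
rewrite big_mkcond; apply: eq_bigr => w _; case: (Q w); by rewrite ?mulr1 ?mulr0.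
Qed.
End Event.

(** An infinite cluster of the origin leaves every box. *)
Lemma theta_one_arm : theta X = (fine (theta X))%:E /\ forall m r, (4 * r.+1 <= m)%N ->
  fine (theta X) <= prob p (fun w => crossing (@adj d m) w (cube 0 r)
    (inner_boundary (@adj d m) (cube 0 r)) 0).
Proof.
pose E m r := [set t | crossing (@adj d m) (cfg m t) (cube 0 r)
  (inner_boundary (@adj d m) (cube 0 r)) 0].
have ThE : [set t | infinite_set (open_cluster R (random_config X t) 0)] =
    \bigcap_r E (4 * r.+1)%N r.
  apply/seteqP; split=> t /=; first by move=> /infinite_clusterP H r _; exact: H.
  by move=> H; apply/infinite_clusterP => r; exact: H.
have mE m r : measurable (E m r).
  exact: (measurable_window (fun w => crossing (@adj d m) w (cube 0 r)
    (inner_boundary (@adj d m) (cube 0 r)) 0)).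
have mTh : measurable [set t | infinite_set (open_cluster R (random_config X t) 0)].
  by rewrite ThE; apply: bigcapT_measurable.
have fin : theta X \is a fin_num.
  have le1 : (theta X <= 1)%E := probability_le1 P mTh.
  by rewrite ge0_fin_numE; [exact: le_lt_trans le1 (ltry _)|exact: measure_ge0].
split=> [|m r mr]; first by rewrite fineK.
rewrite -lee_fin fineK // -window_law; apply: le_measure; rewrite ?inE //.
  exact: (mE m r).
move=> t /= inf.
have zf := @finite_zsup d (2 * r) r (leqnn _).
have [y yr cy] : exists2 y, (r < zsup y)%N & connected_in R (random_config X t) setT 0 y.
  apply: contrapT => none; apply: inf; apply: sub_finite_set zf.
  by move=> y cy /=; rewrite leqNgt; apply/negP => yn; apply: none; exists y.
exact: connected_in_crossing yr cy.
Qed.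

Lemma connection_event_window m (r : R) x y : 0 <= r -> (4 * Num.truncn r <= m)%N ->
  box d r x -> box d r y ->
  connection_event X (box d r) x y =
  [set t | conn (@adj d m) (cfg m t) (cube 0 (Num.truncn r)) (proj m x) (proj m y)].
Proof.
move=> r0 rm xr yr.
have -> : box d r = [set z | (zsup z <= Num.truncn r)%N].
  by apply/seteqP; split=> z /=; [move/(boxE _ r0)|move/(boxE z r0)].
move/(boxE _ r0): xr => xr; move/(boxE _ r0): yr => yr.
apply/seteqP; split=> t /=; first exact: connected_in_window.
move/(window_connected_in R rm); rewrite !projK //; lia.
Qed.

Lemma site_prob_bounds : (0 < theta X)%E -> 0 < p <= 1.
Proof.
move=> th; have [thE arm] := theta_one_arm.
have p01 : 0 <= p <= 1.
  have := site_law 0 true; rewrite /= => pE; apply/andP; split.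
    by rewrite -lee_fin -pE.
  by rewrite -lee_fin -pE; apply: probability_le1; apply: measurable_funPTI.
have /andP[p0 p1] := p01; rewrite p1 andbT.
have := arm 4%N 0%N isT; rewrite prob_crossing => H.
rewrite lt_neqAle p0 andbT; apply/negP => /eqP pE.
by move: H; rewrite -pE mul0r leNgt => /negP; apply; rewrite -lte_fin -thE.
Qed.
End Law.

(** * Choice of the scales *)

Section Scales.
Context (R : realType).

Lemma threshold_ge (x : R) : 2 <= x ->
  4 * x <= (4 * x ^+ 2 + 5 * x - 5) / (2 * x ^+ 2 + 3 * x - 3) * (3 * x - 1).
Proof.
move=> x2; have D0 : 0 < 2 * x ^+ 2 + 3 * x - 3 by nra.
rewrite mulrAC ler_pdivlMr //.
(* the difference of the two sides after clearing denominators, around [x = 2] *)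
have : 0 <= (x - 2) * (4 * x ^+ 2 + 7 * x + 6) + 17 by rewrite addr_ge0 // mulr_ge0 //; nra.
by move=> H; rewrite -subr_ge0; apply: le_trans H _; rewrite le_eqVlt; apply/orP; left; apply/eqP; ring.
Qed.

Lemma le_truncn_powR (a : R) (n : nat) : (0 < n)%N -> 1 <= a -> (n <= Num.truncn (n%:R `^ a))%N.
Proof. by move=> n0 a1; rewrite truncn_ge_nat ?powR_ge0 // le1r_powR // ler1n. Qed.

(** The quantity to make small is of order [n ^ (2 d)] over the square root of
    [N = n ^ a], which tends to zero as soon as [a > 4 d]. The averaging cube of
    [prob_two_arms_le], of size [M.+1], and its translates by up to [M + 3 n] must
    fit in the cube of size [N], whence [M = N %/ 4]. *)
Lemma large_scale (C c a : R) (d : nat) : (2 <= d)%N -> 0 < c -> 0 <= C -> 4 * d%:R < a ->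
  exists n0, forall n, (n0 <= n)%N ->
    let N := Num.truncn (n%:R `^ a) in let M := (N %/ 4)%N in
    (M.+1 + M + 3 * n <= N)%N /\
    C / Num.sqrt M.+1%:R * ((2 * n.+1%:R) ^+ d) ^+ 2 <= c.
Proof.
move=> d2 c0 C0 da; pose b := a - 4 * d%:R; have b0 : 0 < b by rewrite subr_gt0.
pose L := 2 * C * (4 ^+ d) ^+ 2 / c.
have L0 : 0 <= L by rewrite divr_ge0 ?mulr_ge0 ?exprn_ge0 // ltW.
(* from this [n] on, [n ^ b >= L ^ 2] *)
exists (Num.truncn ((L ^+ 2) `^ b^-1)).+2 => n nn0 N M.
have n2 : (2 <= n)%N by apply: leq_trans nn0.
have n0 : (0 < n)%N by apply: ltn_trans n2.
have nr0 : 0 < n%:R :> R by rewrite ltr0n.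
have nL : L ^+ 2 <= n%:R `^ b.
  have -> : L ^+ 2 = ((L ^+ 2) `^ b^-1) `^ b.
    by rewrite -powRrM mulVf ?gt_eqF // powRr1 // exprn_ge0.
  apply: ge0_ler_powR; rewrite ?nnegrE ?powR_ge0 ?(ltW b0) //.
  apply: ltW; apply: lt_le_trans (truncnS_gt _) _; rewrite ler_nat.
  by apply: leq_trans nn0.
pose y : R := n%:R `^ a.
have yE : y = n%:R ^+ (4 * d) * n%:R `^ b.
  rewrite /y -powR_mulrn // natrM -powRD; last by rewrite (gt_eqF nr0) implybT.
  by congr (_ `^ _); rewrite /b addrC subrK.
have y0 : 0 <= y by apply: powR_ge0.
have yN : y < N.+1%:R by apply: truncnS_gt.
split.
  have H : (6 * n + 2 <= N)%N.
    rewrite /N truncn_ge_nat // -/y; apply: (@le_trans _ _ (n%:R ^+ (4 * d))).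
      rewrite -natrX ler_nat; apply: (@leq_trans (n ^ 8)).
        apply: (@leq_trans (2 ^ 7 * n)).
          by apply: (@leq_trans (7 * n)); [clear -n2; lia|rewrite leq_mul2r orbT].
        by rewrite [(n ^ 8)%N]expnSr leq_mul2r leq_exp2r // n2 orbT.
      by rewrite leq_pexp2l //; clear -d2; lia.
    rewrite yE ler_peMr ?exprn_ge0 // -[leLHS](powRr0 n%:R); apply: ler_powR; last exact: ltW.
    by rewrite ler1n.
  by rewrite /M; clear -H; lia.
have MN : y / 4 <= M.+1%:R.
  rewrite ler_pdivrMr // -natrM; apply: le_trans (ltW yN) _; rewrite ler_nat /M; clear; lia.
have sM : n%:R ^+ (2 * d) * L / 2 <= Num.sqrt M.+1%:R.
  have H0 : 0 <= n%:R ^+ (2 * d) * L / 2 by rewrite divr_ge0 // mulr_ge0 // exprn_ge0.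
  rewrite -(ger0_norm H0) -sqrtr_sqr; apply: ler_wsqrtr; apply: le_trans MN.
  rewrite yE expr_div_n exprMn -exprM (_ : (2 * d * 2 = 4 * d)%N); last by clear; lia.
  have -> : 2 ^+ 2 = 4 :> R by rewrite -natrX.
  by rewrite ler_pM2r ?invr_gt0 // ler_pM2l // exprn_gt0.
have s0 : 0 < Num.sqrt M.+1%:R :> R by rewrite sqrtr_gt0.
rewrite mulrAC ler_pdivrMr //.
apply: (@le_trans _ _ (c * (n%:R ^+ (2 * d) * L / 2))); last by rewrite ler_pM2l.
have -> : c * (n%:R ^+ (2 * d) * L / 2) = C * ((4 * n%:R) ^+ d) ^+ 2.
  rewrite /L exprMn mulnC exprM [in RHS]exprMn; field; by rewrite gt_eqF.
apply: ler_wpM2l => //; rewrite !lerXn2r ?nnegrE ?exprn_ge0 ?mulr_ge0 //.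
by rewrite -!natrM ler_nat; clear -n2; lia.
Qed.
End Scales.

Theorem theorem1p3 (R : realType) (d : nat) (p alpha : R)
    (disp : measure_display) (T : measurableType disp) (P : probability T R)
    (X : site d -> {RV P >-> bool}) :
  (2 <= d)%N ->
  site_percolation p X ->
  (0 < theta X)%E ->
  alpha > (4 * d%:R ^+ 2 + 5 * d%:R - 5) / (2 * d%:R ^+ 2 + 3 * d%:R - 3)
            * (3 * d%:R - 1) ->
  (0 < ereal_inf
         [set ereal_inf
                [set P (connection_event X (box d (n%:R `^ alpha)) x y)
                | x in box d (n%:R : R) & y in box d (n%:R : R)]
         | n in [set n : nat | (1 <= n)%N]])%E.
Proof.
move=> d2 perc th halpha; have d0 : (0 < d)%N by apply: ltn_trans d2.
have dR : 2 <= d%:R :> R by rewrite ler_nat.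
have alpha4 : 4 * d%:R < alpha by apply: le_lt_trans halpha; apply: threshold_ge.
have alpha1 : 1 <= alpha by apply: ltW; apply: lt_trans alpha4; lra.
have p01 := site_prob_bounds perc th; have /andP[p0 p1] := p01.
have [thE arm] := theta_one_arm perc.
set th0 := fine (theta X) in thE arm.
have th0_gt0 : 0 < th0 by rewrite -lte_fin -thE.
have c0 : 0 < th0 ^+ 3 / 2 by rewrite divr_gt0 // exprn_gt0.
have C0 := two_arms_const_ge0 d p01.
have [n0 big] := large_scale d2 c0 C0 alpha4.
(* [c1] serves for the finitely many [n < n0], by unit steps; [c2] for the others *)
pose c1 := p ^+ (4 * n0).+1; pose c2 := (th0 ^+ 2 / 2) ^+ 2 * p ^+ 3.
have c1_gt0 : 0 < c1 by rewrite exprn_gt0.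
have c2_gt0 : 0 < c2 by rewrite mulr_gt0 ?exprn_gt0 // divr_gt0 // exprn_gt0.
pose c := Num.min 1 (Num.min c1 c2).
have c_gt0 : 0 < c by rewrite !lt_min ltr01 c1_gt0.
have c_le : [/\ c <= 1, c <= c1 & c <= c2] by rewrite /c !ge_min !lexx !orbT.
have [c_le1 c_lec1 c_lec2] := c_le.
apply: (@lt_le_trans _ _ (p * c ^+ d)%:E).
  by rewrite lte_fin mulr_gt0 // exprn_gt0.
apply: le_ereal_inf_tmp => _ [n /= n1 <-].
apply: le_ereal_inf_tmp => _ [x xn [y yn <-]].
have [N NE] : exists N, N = Num.truncn (n%:R `^ alpha : R) by eexists.
have nN : (n <= N)%N by rewrite NE; apply: le_truncn_powR.
(* a period large enough for the cube of size [2 N] not to wrap around *)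
have [m [m0 armN Nm]] : exists m, [/\ (0 < m)%N,
    forall r, (r <= N + N)%N -> (4 * r.+1 <= m)%N & (8 * N <= m)%N].
  by exists (8 * N + 8)%N; clear; split; [lia|move=> r; lia|lia].
have rm : (4 * N <= m)%N by clear -Nm; lia.
move/(boxE _ (ler0n _ n)): xn; move/(boxE _ (ler0n _ n)): yn; rewrite natrK => yn xn.
have inbox z : (zsup z <= n)%N -> box d (n%:R `^ alpha) z.
  by move=> zn; apply/boxE; rewrite ?powR_ge0 // -NE; exact: leq_trans nN.
rewrite (connection_event_window (m := m) _ (powR_ge0 _ _) _ (inbox _ xn) (inbox _ yn));
  last by rewrite -NE.
rewrite -NE (window_law perc (fun w => conn (@adj d m) w (cube 0 N) (proj m x) (proj m y))) lee_fin.
have in_cube z : (zsup z <= n)%N -> proj m z \in cube 0 n.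
  by move=> zn; rewrite cube0 supnrm_proj //; clear -zn nN rm; lia.
apply: (@linked_coordinates _ _ _ _ _ p01 _ n) => //.
- by rewrite (ltW c_gt0).
- exact: in_cube.
- exact: in_cube.
move=> z i b k zn z'n kn.
have [nn0|nn0] := leqP n0 n.
  have [] := big n nn0; rewrite -NE => MN small.
  apply: linked_le c_lec2 _; apply: linked_axis kn zn small => //.
  - by move=> r rN; apply: arm; apply: armN.
  - by apply: leq_trans (leq_div _ _) _; clear -Nm; lia.
apply: linked_le c_lec1 _; apply: (@linked_le _ _ _ _ _ (p ^+ (2 * k).+1)).
  by rewrite /c1 ler_wiXn2l ?(ltW p0) //; clear -kn nn0; lia.
by apply: linked_walk_cube kn zn z'n => //; clear -nN Nm; lia.
Qed.
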